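(* Let $G=(V,E)$ be a chordal graph. Then $\Gamma(G)$ is the limit over $\mathcal{S}(G)$ of the functor $P$, that is, $$ \Gamma(G) \;\cong\; \lim_{\mathcal{S}(G)} P = \left\{ (\gamma_S)_{S\in\mathcal{S}(G)}\in \prod_{S\in\mathcal{S}(G)} P(S)\ \middle|\ \rho_{TS}(\gamma_S) = \gamma_T \ \text{ for all } T\subseteq S \text{ in } \mathcal{S}(G) \right\}. $$
   Context: Graphs $G=(V,E)$ are finite and simple. A cycle of length $k\ge 3$ is a sequence $v_1,\dots,v_k$ of pairwise distinct vertices such that $\{v_k,v_1\}$ and all $\{v_i,v_{i+1}\}$, $1\le i\le k-1$, are edges; a chord of it is an edge $\{v_i,v_j\}$ distinct from these. $G$ is chordal if every cycle of length $\ge 4$ admits at least one chord. A subset $S\subseteq V$ is a simplex of $G$ if $\{s,s'\}\in E$ for all $s\neq s'$ in $S$. $\mathcal{S}(G)$ denotes the poset of non-empty simplices of $G$, ordered by inclusion. For a graph $G=(V,E)$, $X(G)=\{(x_v)_{v\in V}\in\mathbb{C}^V : x_i\ne x_j \text{ for all } \{i,j\}\in E\}$ is the complement of the complex graphical arrangement, and $\Gamma(G)=\pi_1(X(G))$. For a finite set $I$, $C_I$ is the complete graph on $I$ and $P(I)=\pi_1(X(C_I))$ (the colored, i.e. pure, braid group on $|I|$ strands). For $J\subseteq I$, $\rho_{JI}:P(I)\to P(J)$ is the homomorphism induced on $\pi_1$ by the coordinate projection $X(C_I)\to X(C_J)$; this makes $P$ a contravariant functor on the poset $\mathcal{S}(G)$.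 Spaces are pointed and maps preserve base points: fix a base point of $\mathbb{C}^V$ with pairwise distinct coordinates, and use it and its coordinate projections as base points of all the spaces involved. *)

(* Defs.v *)
From HB Require Import structures.
From mathcomp Require Import all_boot all_order all_algebra.
From mathcomp Require Import generic_quotient monoid.
From mathcomp Require Import complex.
From mathcomp Require Import mathcomp_extra boolp classical_sets functions.
From mathcomp Require Import set_interval reals topology normedtype.
From mathcomp Require Import homotopy.
From mathcomp Require Import lra.

Set Implicit Arguments.
Unset Strict Implicit.
Unset Printing Implicit Defensive.

Import Order.TTheory GRing.Theory Num.Theory.
Import numFieldNormedType.Exports.

Local Open Scope classical_set_scope.
Local Open Scope ring_scope.
Local Open Scope quotient_scope.

Definition unitI (R : realType) : Type := (`[0, 1]%classic : set R).

Section UnitInterval.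
Variable R : realType.
Local Notation I := (unitI R).

HB.instance Definition _ := Topological.on I.

Definition unitI_val : I -> R := set_val.

Lemma clamp_subproof (r : R) :
  Num.max 0 (Num.min 1 r) \in (`[0, 1]%classic : set R).
Proof.
by rewrite inE /= in_itv /= le_max lexx ge_max ler01 ge_min lexx.
Qed.

Definition clamp (r : R) : I :=
  @exist R (fun x => x \in (`[0, 1]%classic : set R)) _ (clamp_subproof r).

Lemma unitI_ge0 (t : I) : 0 <= unitI_val t.
Proof. by case: t => r /= h; move: (set_mem h); rewrite /= in_itv /= => /andP[]. Qed.

Lemma unitI_le1 (t : I) : unitI_val t <= 1.
Proof. by case: t => r /= h; move: (set_mem h); rewrite /= in_itv /= => /andP[]. Qed.

Lemma unitI_val_clamp (r : R) :
  unitI_val (clamp r) = Num.max 0 (Num.min 1 r).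
Proof. by []. Qed.

Lemma clampE (r : R) : 0 <= r -> r <= 1 -> unitI_val (clamp r) = r.
Proof. by move=> r0 r1; rewrite unitI_val_clamp (min_r r1) (max_r r0). Qed.

Lemma unitI_inj : injective unitI_val.
Proof. exact: val_inj. Qed.

Lemma unitI_valK : cancel unitI_val clamp.
Proof. by move=> t; apply: unitI_inj; rewrite clampE ?unitI_ge0 ?unitI_le1. Qed.

Lemma clamp_le0 (r : R) : r <= 0 -> clamp r = clamp 0.
Proof.
move=> r0; apply: unitI_inj; rewrite (@clampE 0) ?ler01// unitI_val_clamp.
by rewrite (min_r (le_trans r0 ler01)) (max_l r0).
Qed.

Lemma clamp_ge1 (r : R) : 1 <= r -> clamp r = clamp 1.
Proof.
move=> r1; apply: unitI_inj; rewrite (@clampE 1) ?ler01// unitI_val_clamp.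
by rewrite (min_l r1) (max_r ler01).
Qed.

Lemma unitI_val_continuous : continuous unitI_val.
Proof. exact: initial_continuous. Qed.

Lemma clamp_continuous : continuous clamp.
Proof.
apply: continuous_comp_initial.
have : continuous ((fun=> 0 : R) \max ((fun=> 1) \min id)).
  apply: max_fun_continuous; first by move=> ?; exact: cvg_cst.
  by apply: min_fun_continuous => ?; [exact: cvg_cst|exact: cvg_id].
exact.
Qed.

Lemma unitI_zero_neq_one : clamp 0 != clamp 1.
Proof.
apply/eqP => /(congr1 unitI_val).
by rewrite !clampE ?ler01// => /esym/eqP; rewrite oner_eq0.
Qed.

HB.instance Definition _ := isBiPointed.Build I unitI_zero_neq_one.

Lemma unitI_zeroE : zero = clamp 0. Proof. by []. Qed.
Lemma unitI_oneE : one = clamp 1. Proof. by []. Qed.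

End UnitInterval.

Lemma paste_continuous (R : realType) (W T : topologicalType) (c : R)
    (u : W -> R) (f g : W -> T) :
  continuous u -> continuous f -> continuous g ->
  (forall w, u w = c -> f w = g w) ->
  continuous (fun w => if u w <= c then f w else g w).
Proof.
move=> cu cf cg fg; apply/continuous_subspace_setT.
have -> : [set: W] = [set w | u w <= c] `|` [set w | c <= u w].
  by apply/esym; rewrite -subTset => w _; apply/orP; exact: le_total.
apply: withinU_continuous.
- exact: (closed_comp (fun w _ => cu w) (@closed_le R c)).
- exact: (closed_comp (fun w _ => cu w) (@closed_ge R c)).
- apply: (subspace_eq_continuous (f := f)); last exact: continuous_subspaceT.
  by move=> w /set_mem /= uw; rewrite /from_subspace uw.
- apply: (subspace_eq_continuous (f := g)); last exact: continuous_subspaceT.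
  move=> w /set_mem /= cw; rewrite /from_subspace; case: ifP => // wc.
  by apply/esym/fg/le_anti; rewrite wc.
Qed.

Lemma pair_continuous (W U V : topologicalType) (f : W -> U) (g : W -> V) :
  continuous f -> continuous g -> continuous (fun w => (f w, g w)).
Proof. by move=> cf cg w; apply: cvg_pair; [exact: cf|exact: cg]. Qed.

Lemma affine_continuous (R : realType) (W : topologicalType) (a b : R)
    (u : W -> R) : continuous u -> continuous (fun w => a * u w + b).
Proof.
move=> cu w; apply: (@cvgD R R^o); last exact: cvg_cst.
by apply: cvgM; [exact: cvg_cst|exact: cu].
Qed.

Section FundamentalGroup.
Variables (R : realType) (T : topologicalType) (x : T).
Local Notation I := (unitI R).
Local Notation val := (@unitI_val R).
Local Notation clamp := (@clamp R).

Definition loop : Type := {path I from x to x in T}.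

HB.instance Definition _ := Choice.on loop.

Definition loop_fun (p : loop) : I -> T := p.

(* Homotopy relative to the end points. *)
Definition homotopic (p q : loop) : Prop :=
  exists H : I * I -> T,
    [/\ continuous H,
        forall t, H (zero, t) = loop_fun p t,
        forall t, H (one, t) = loop_fun q t,
        forall s, H (s, zero) = x
      & forall s, H (s, one) = x].

Lemma loop_continuous (p : loop) : continuous (loop_fun p).
Proof. exact: cts_fun. Qed.

Lemma loop_eq (p q : loop) : loop_fun p =1 loop_fun q -> p = q.
Proof. by move=> pq; apply/path_eqP. Qed.

(* A loop, extended to R by x outside the unit interval. *)
Definition extend (p : loop) (r : R) : T := loop_fun p (clamp r).

Lemma extend_continuous p : continuous (extend p).
Proof.
move=> r; apply: continuous_comp; first exact: clamp_continuous.
exact: loop_continuous.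
Qed.

Lemma extend_le0 p r : r <= 0 -> extend p r = x.
Proof. by move=> r0; rewrite /extend clamp_le0// /loop_fun path_zero. Qed.

Lemma extend_ge1 p r : 1 <= r -> extend p r = x.
Proof. by move=> r0; rewrite /extend clamp_ge1// /loop_fun path_one. Qed.

Lemma extend_val p t : extend p (val t) = loop_fun p t.
Proof. by rewrite /extend unitI_valK. Qed.

Section RealLoop.
Variables (f : R -> T) (cf : continuous f) (f0 : f 0 = x) (f1 : f 1 = x).

Lemma loop_of_continuous : continuous (f \o val).
Proof.
by move=> t; apply: continuous_comp; [exact: unitI_val_continuous|exact: cf].
Qed.

Lemma loop_of_zero : (f \o val) zero = x.
Proof. by rewrite /= unitI_zeroE clampE ?ler01. Qed.

Lemma loop_of_one : (f \o val) one = x.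
Proof. by rewrite /= unitI_oneE clampE ?ler01. Qed.

Definition loop_of : loop :=
  mk_path loop_of_continuous loop_of_zero loop_of_one.

Lemma loop_ofE t : loop_fun loop_of t = f (val t).
Proof. by []. Qed.

End RealLoop.

Lemma homotopic_refl p : homotopic p p.
Proof.
exists (fun st => loop_fun p st.2); split=> //.
- by move=> st; apply: continuous_comp; [exact: cvg_snd|exact: loop_continuous].
- by move=> s; rewrite /loop_fun /= path_zero.
- by move=> s; rewrite /loop_fun /= path_one.
Qed.

Lemma clamp_affine_continuous (W : topologicalType) (a b : R) (u : W -> I) :
  continuous u -> continuous (fun w => clamp (a * val (u w) + b)).
Proof.
move=> cu w; apply: (@continuous_comp _ _ _ (fun w => a * val (u w) + b) clamp);
  last exact: clamp_continuous.
apply: affine_continuous => {}w; apply: continuous_comp; first exact: cu.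
exact: unitI_val_continuous.
Qed.

Lemma fst_continuous (U V : topologicalType) : continuous (@fst U V).
Proof. by move=> w; exact: cvg_fst. Qed.

Lemma snd_continuous (U V : topologicalType) : continuous (@snd U V).
Proof. by move=> w; exact: cvg_snd. Qed.

Lemma val0 : val zero = 0. Proof. by rewrite unitI_zeroE clampE ?ler01. Qed.
Lemma val1 : val one = 1. Proof. by rewrite unitI_oneE clampE ?ler01. Qed.

Lemma homotopic_sym p q : homotopic p q -> homotopic q p.
Proof.
move=> [H [cH H0 H1 Hz Ho]].
exists (fun st => H (clamp (- 1 * val st.1 + 1), st.2)); split.
- move=> st; apply: (@continuous_comp _ _ _
    (fun st : I * I => (clamp (- 1 * val st.1 + 1), st.2)) H); last exact: cH.
  apply: pair_continuous; last exact: snd_continuous.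
  exact/clamp_affine_continuous/fst_continuous.
- by move=> t; rewrite /= val0 mulr0 add0r -unitI_oneE H1.
- by move=> t; rewrite /= val1 mulr1 addNr -unitI_zeroE H0.
- by move=> s; exact: Hz.
- by move=> s; exact: Ho.
Qed.

Lemma homotopic_trans p q r :
  homotopic p q -> homotopic q r -> homotopic p r.
Proof.
move=> [H [cH H0 H1 Hz Ho]] [K [cK K0 K1 Kz Ko]].
exists (fun st => if val st.1 <= 2^-1 then H (clamp (2 * val st.1 + 0), st.2)
                  else K (clamp (2 * val st.1 + -1), st.2)); split.
- apply: (@paste_continuous R _ _ 2^-1 (fun st : I * I => val st.1)
    (fun st => H (clamp (2 * val st.1 + 0), st.2))
    (fun st => K (clamp (2 * val st.1 + -1), st.2))).
  + move=> st; apply: continuous_comp; first exact: fst_continuous.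
    exact: unitI_val_continuous.
  + move=> st; apply: (@continuous_comp _ _ _
      (fun st : I * I => (clamp (2 * val st.1 + 0), st.2)) H); last exact: cH.
    apply: pair_continuous; last exact: snd_continuous.
    exact/clamp_affine_continuous/fst_continuous.
  + move=> st; apply: (@continuous_comp _ _ _
      (fun st : I * I => (clamp (2 * val st.1 + -1), st.2)) K); last exact: cK.
    apply: pair_continuous; last exact: snd_continuous.
    exact/clamp_affine_continuous/fst_continuous.
  + move=> [s t] /= ->.
    rewrite divff ?pnatr_eq0// addr0 subrr.
    by rewrite -unitI_oneE -unitI_zeroE H1 K0.
- move=> t /=; rewrite val0 invr_ge0 ler0n mulr0 addr0.
  by rewrite -unitI_zeroE H0.
- move=> t /=; rewrite val1 ifF; last by apply/negbTE; rewrite -ltNge; lra.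
  by rewrite (_ : 2 * 1 + -1 = 1 :> R) ?K1//; lra.
- by move=> s /=; case: ifP => _; [exact: Hz|exact: Kz].
- by move=> s /=; case: ifP => _; [exact: Ho|exact: Ko].
Qed.

(* Two reparametrizations of the same curve are homotopic, by convexity. *)
Lemma homotopic_reparam (f : R -> T) (phi psi : R -> R) (p q : loop) :
  continuous f -> continuous phi -> continuous psi ->
  (forall t, loop_fun p t = f (phi (val t))) ->
  (forall t, loop_fun q t = f (psi (val t))) ->
  phi 0 = psi 0 -> phi 1 = psi 1 -> homotopic p q.
Proof.
move=> cf cphi cpsi pE qE e0 e1.
have fphi0 : f (phi 0) = x by rewrite -val0 -pE /loop_fun path_zero.
have fphi1 : f (phi 1) = x by rewrite -val1 -pE /loop_fun path_one.
pose h (st : I * I) : R :=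
  (-1 * val st.1 + 1) * phi (val st.2) + val st.1 * psi (val st.2).
have cv1 : continuous (fun st : I * I => val st.1).
  move=> st; apply: continuous_comp; first exact: fst_continuous.
  exact: unitI_val_continuous.
have cv2 : continuous (fun st : I * I => val st.2).
  move=> st; apply: continuous_comp; first exact: snd_continuous.
  exact: unitI_val_continuous.
have ch : continuous h.
  move=> st; apply: (@cvgD R R^o); apply: cvgM.
  - exact: (affine_continuous cv1).
  - by apply: continuous_comp; [exact: cv2|exact: cphi].
  - exact: cv1.
  - by apply: continuous_comp; [exact: cv2|exact: cpsi].
exists (f \o h); split.
- by move=> st; apply: continuous_comp; [exact: ch|exact: cf].
- by move=> t; rewrite pE /h /= val0; congr f; lra.
- by move=> t; rewrite qE /h /= val1; congr f; lra.
- by move=> s; rewrite -fphi0 /h /= val0 -e0; congr f; lra.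
- by move=> s; rewrite -fphi1 /h /= val1 -e1; congr f; lra.
Qed.

Definition concat_fun (p q : loop) (r : R) : T :=
  if r <= 2^-1 then extend p (2 * r + 0) else extend q (2 * r + -1).

Lemma concat_continuous p q : continuous (concat_fun p q).
Proof.
apply: (@paste_continuous R _ _ 2^-1 id (fun r => extend p (2 * r + 0))
  (fun r => extend q (2 * r + -1))).
- by move=> r; exact: cvg_id.
- move=> r; apply: (@continuous_comp _ _ _ (fun r : R => 2 * r + 0) (extend p));
    last exact: extend_continuous.
  by apply: affine_continuous => ?; exact: cvg_id.
- move=> r; apply: (@continuous_comp _ _ _ (fun r : R => 2 * r + -1) (extend q));
    last exact: extend_continuous.
  by apply: affine_continuous => ?; exact: cvg_id.
- by move=> r ->; rewrite extend_ge1 ?extend_le0//; lra.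
Qed.

Lemma concat_le0 p q r : r <= 0 -> concat_fun p q r = x.
Proof.
move=> r0; rewrite /concat_fun ifT ?extend_le0//; first by lra.
by apply: (le_trans r0); rewrite invr_ge0.
Qed.

Lemma concat_ge1 p q r : 1 <= r -> concat_fun p q r = x.
Proof.
move=> r1; rewrite /concat_fun ifF ?extend_ge1//; first by lra.
by apply/negbTE; rewrite -ltNge; lra.
Qed.

Definition concat (p q : loop) : loop :=
  loop_of (@concat_continuous p q) (@concat_le0 p q 0 (lexx 0))
    (@concat_ge1 p q 1 (lexx 1)).

Lemma extend_concat p q r : extend (concat p q) r = concat_fun p q r.
Proof.
have [r0|r0] := leP r 0; first by rewrite extend_le0// concat_le0.
have [r1|r1] := leP 1 r; first by rewrite extend_ge1// concat_ge1.
by rewrite /extend loop_ofE clampE ?ltW.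
Qed.

Lemma reverse_continuous p : continuous (fun r : R => extend p (-1 * r + 1)).
Proof.
move=> r; apply: (@continuous_comp _ _ _ (fun r : R => -1 * r + 1) (extend p));
  last exact: extend_continuous.
by apply: affine_continuous => ?; exact: cvg_id.
Qed.

Lemma reverse_zero p : extend p (-1 * 0 + 1) = x.
Proof. by rewrite extend_ge1//; lra. Qed.

Lemma reverse_one p : extend p (-1 * 1 + 1) = x.
Proof. by rewrite extend_le0//; lra. Qed.

Definition reverse (p : loop) : loop :=
  loop_of (@reverse_continuous p) (reverse_zero p) (reverse_one p).

Definition constant_loop : loop :=
  loop_of (f := fun=> x) (fun _ => cvg_cst x) erefl erefl.

Lemma extend_constant r : extend constant_loop r = x.
Proof. by []. Qed.

Lemma extend_reverse p r : extend (reverse p) r = extend p (-1 * r + 1).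
Proof.
have [r0|r0] := leP r 0.
  by rewrite extend_le0// extend_ge1//; lra.
have [r1|r1] := leP 1 r.
  by rewrite extend_ge1// extend_le0//; lra.
by rewrite /extend loop_ofE clampE ?ltW.
Qed.

Lemma concat_homotopic p p' q q' : homotopic p p' -> homotopic q q' ->
  homotopic (concat p q) (concat p' q').
Proof.
move=> [H [cH H0 H1 Hz Ho]] [K [cK K0 K1 Kz Ko]].
have cl0 r : r <= 0 -> clamp r = zero by move=> ?; exact: clamp_le0.
have cl1 r : 1 <= r -> clamp r = one by move=> ?; exact: clamp_ge1.
exists (fun st => if val st.2 <= 2^-1 then H (st.1, clamp (2 * val st.2 + 0))
                  else K (st.1, clamp (2 * val st.2 + -1))); split.
- apply: (@paste_continuous R _ _ 2^-1 (fun st : I * I => val st.2)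
    (fun st => H (st.1, clamp (2 * val st.2 + 0)))
    (fun st => K (st.1, clamp (2 * val st.2 + -1)))).
  + move=> st; apply: continuous_comp; first exact: snd_continuous.
    exact: unitI_val_continuous.
  + move=> st; apply: (@continuous_comp _ _ _
      (fun st : I * I => (st.1, clamp (2 * val st.2 + 0))) H); last exact: cH.
    apply: pair_continuous; first exact: fst_continuous.
    exact/clamp_affine_continuous/snd_continuous.
  + move=> st; apply: (@continuous_comp _ _ _
      (fun st : I * I => (st.1, clamp (2 * val st.2 + -1))) K); last exact: cK.
    apply: pair_continuous; first exact: fst_continuous.
    exact/clamp_affine_continuous/snd_continuous.
  + by move=> [s t] /= ->; rewrite cl1 ?cl0 ?Ho ?Kz//; lra.
- by move=> t; rewrite loop_ofE /concat_fun /extend /=; case: ifP.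
- by move=> t; rewrite loop_ofE /concat_fun /extend /=; case: ifP.
- by move=> s /=; rewrite val0 invr_ge0 ler0n cl0 ?Hz//; lra.
- move=> s /=; rewrite val1 ifF; last by apply/negbTE; rewrite -ltNge; lra.
  by rewrite cl1 ?Ko//; lra.
Qed.

Lemma min_affine_continuous (a b c d : R) :
  continuous (fun r : R => Num.min (a * r + b) (c * r + d)).
Proof.
apply: (@min_fun_continuous _ _ _ (fun r => a * r + b) (fun r => c * r + d));
  by apply: affine_continuous => ?; exact: cvg_id.
Qed.

Lemma id_continuous : continuous (@id R).
Proof. by move=> ?; exact: cvg_id. Qed.

Lemma concatA p q r :
  homotopic (concat p (concat q r)) (concat (concat p q) r).
Proof.
pose phi (t : R) := Num.min (2 * t + 0) (Num.min (1 * t + 4^-1) (2^-1 * t + 2^-1)).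
apply: (@homotopic_reparam (extend (concat p (concat q r))) id phi).
- exact: extend_continuous.
- exact: id_continuous.
- rewrite /phi; apply: (@min_fun_continuous _ _ _ (fun t : R => 2 * t + 0)
    (fun t : R => Num.min (1 * t + 4^-1) (2^-1 * t + 2^-1))).
    exact/affine_continuous/id_continuous.
  exact: min_affine_continuous.
- by move=> t; rewrite extend_val.
- move=> t; rewrite loop_ofE; move: (val t) => {}t.
  rewrite extend_concat /concat_fun !extend_concat /concat_fun.
  have [t2|t2] := leP t 2^-1.
    have [t4|t4] := leP (2 * t + 0) 2^-1.
      have -> : phi t = 2 * t + 0.
        by rewrite /phi min_l// le_min; apply/andP; split; lra.
      by rewrite t4.
    have -> : phi t = t + 4^-1.
      rewrite /phi min_r; last by rewrite ge_min; apply/orP; left; lra.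
      by rewrite min_l; lra.
    rewrite ifF; last by apply/negbTE; rewrite -ltNge; lra.
    by rewrite ifT; [congr extend|]; lra.
  have -> : phi t = 2^-1 * t + 2^-1.
    rewrite /phi min_r; last by rewrite ge_min; apply/orP; right; lra.
    by rewrite min_r; lra.
  rewrite ifF; last by apply/negbTE; rewrite -ltNge; lra.
  rewrite ifF; last by apply/negbTE; rewrite -ltNge; lra.
  by congr extend; lra.
- by rewrite /phi min_l; [lra|rewrite le_min; apply/andP; split; lra].
- rewrite /phi min_r; last by rewrite ge_min; apply/orP; right; lra.
  by rewrite min_r; lra.
Qed.

Lemma concat1p p : homotopic (concat constant_loop p) p.
Proof.
apply: (@homotopic_reparam (extend p)
  (fun t => Num.max (0 * t + 0) (2 * t + -1)) id).
- exact: extend_continuous.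
- apply: (@max_fun_continuous _ _ _ (fun t : R => 0 * t + 0)
    (fun t => 2 * t + -1));
    exact/affine_continuous/id_continuous.
- exact: id_continuous.
- move=> t; rewrite loop_ofE /concat_fun; case: leP => t2.
    by rewrite max_l ?extend_constant ?extend_le0//; lra.
  by rewrite max_r//; lra.
- by move=> t; rewrite extend_val.
- by rewrite max_l; lra.
- by rewrite max_r; lra.
Qed.

Lemma concatp1 p : homotopic (concat p constant_loop) p.
Proof.
apply: (@homotopic_reparam (extend p)
  (fun t => Num.min (2 * t + 0) (0 * t + 1)) id).
- exact: extend_continuous.
- exact: min_affine_continuous.
- exact: id_continuous.
- move=> t; rewrite loop_ofE /concat_fun; case: leP => t2.
    by rewrite min_l//; lra.
  by rewrite min_r ?extend_constant ?extend_ge1//; lra.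
- by move=> t; rewrite extend_val.
- by rewrite min_l; lra.
- by rewrite min_r; lra.
Qed.

Lemma concatpV p : homotopic (concat p (reverse p)) constant_loop.
Proof.
apply: (@homotopic_reparam (extend p)
  (fun t => Num.min (2 * t + 0) (-2 * t + 2)) (fun=> 0)).
- exact: extend_continuous.
- exact: min_affine_continuous.
- by move=> ?; exact: cvg_cst.
- move=> t; rewrite loop_ofE /concat_fun extend_reverse; case: leP => t2.
    by rewrite min_l//; lra.
  by rewrite min_r; [congr extend|]; lra.
- by move=> t; rewrite loop_ofE extend_le0.
- by rewrite min_l; lra.
- by rewrite min_r; lra.
Qed.

Lemma reverseK p : reverse (reverse p) = p.
Proof.
apply: loop_eq => t; rewrite loop_ofE extend_reverse -extend_val.
by congr extend; lra.
Qed.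

Lemma concatVp p : homotopic (concat (reverse p) p) constant_loop.
Proof. by rewrite -{2}[p]reverseK; exact: concatpV. Qed.

End FundamentalGroup.

Section FundamentalGroupStructure.
Variables (R : realType) (T : topologicalType) (x : T).
Implicit Types p q r : loop R x.

Definition homotopic_rel : rel (loop R x) := fun p q => `[< homotopic p q >].

Lemma homotopic_rel_refl : reflexive homotopic_rel.
Proof. by move=> p; apply/asboolP; exact: homotopic_refl. Qed.

Lemma homotopic_rel_sym : symmetric homotopic_rel.
Proof. by move=> p q; apply/asboolP/asboolP; exact: homotopic_sym. Qed.

Lemma homotopic_rel_trans : transitive homotopic_rel.
Proof.
by move=> q p r /asboolP pq /asboolP qr; apply/asboolP; exact: homotopic_trans qr.
Qed.

Canonical homotopic_equiv :=
  EquivRel homotopic_rel homotopic_rel_refl homotopic_rel_sym homotopic_rel_trans.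

Definition pi1 : Type := {eq_quot homotopic_equiv}.

HB.instance Definition _ := Choice.on pi1.
HB.instance Definition _ := EqQuotient.on pi1.

Definition loop_class (p : loop R x) : pi1 := \pi p.

Lemma loop_classP p q : loop_class p = loop_class q <-> homotopic p q.
Proof. by split=> [/eqmodP/asboolP|pq]; last exact/eqmodP/asboolP. Qed.

Lemma repr_loop_class p : homotopic (repr (loop_class p)) p.
Proof. by apply/loop_classP; rewrite /loop_class reprK. Qed.

Lemma loop_class_surj (u : pi1) : exists p, u = loop_class p.
Proof. by exists (repr u); rewrite /loop_class reprK. Qed.

Definition pi1_one : pi1 := loop_class (constant_loop R x).
Definition pi1_mul (u v : pi1) : pi1 := loop_class (concat (repr u) (repr v)).
Definition pi1_inv (u : pi1) : pi1 := loop_class (reverse (repr u)).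

Lemma pi1_mul_class p q :
  pi1_mul (loop_class p) (loop_class q) = loop_class (concat p q).
Proof. by apply/loop_classP/concat_homotopic; exact: repr_loop_class. Qed.

Lemma pi1_mulA : associative pi1_mul.
Proof.
move=> u v w; have [p ->] := loop_class_surj u; have [q ->] := loop_class_surj v.
have [r ->] := loop_class_surj w; rewrite !pi1_mul_class.
exact/loop_classP/concatA.
Qed.

Lemma pi1_mul1g : left_id pi1_one pi1_mul.
Proof.
move=> u; have [p ->] := loop_class_surj u; rewrite pi1_mul_class.
exact/loop_classP/concat1p.
Qed.

Lemma pi1_mulg1 : right_id pi1_one pi1_mul.
Proof.
move=> u; have [p ->] := loop_class_surj u; rewrite pi1_mul_class.
exact/loop_classP/concatp1.
Qed.

Lemma pi1_mulVg : left_inverse pi1_one pi1_inv pi1_mul.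
Proof.
move=> u; rewrite -{2}[u]reprK pi1_mul_class; exact/loop_classP/concatVp.
Qed.

Lemma pi1_mulgV : right_inverse pi1_one pi1_inv pi1_mul.
Proof.
move=> u; rewrite -{1}[u]reprK pi1_mul_class; exact/loop_classP/concatpV.
Qed.

HB.instance Definition _ := isGroup.Build pi1
  pi1_mulA pi1_mul1g pi1_mulg1 pi1_mulVg pi1_mulgV.

Lemma loop_classM p q :
  (loop_class p * loop_class q)%g = loop_class (concat p q).
Proof. exact: pi1_mul_class. Qed.

Lemma loop_class1 : loop_class (constant_loop R x) = 1%g.
Proof. by []. Qed.

End FundamentalGroupStructure.

Section InducedMorphism.
Variables (R : realType) (T U : topologicalType) (x : T) (y : U).
Variables (f : T -> U) (cf : continuous f) (fx : f x = y).
Implicit Types p q : loop R x.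

Lemma loop_map_continuous p : continuous (f \o loop_fun p).
Proof.
by move=> t; apply: continuous_comp; [exact: loop_continuous|exact: cf].
Qed.

Lemma loop_map_zero p : (f \o loop_fun p) zero = y.
Proof. by rewrite /= /loop_fun path_zero. Qed.

Lemma loop_map_one p : (f \o loop_fun p) one = y.
Proof. by rewrite /= /loop_fun path_one. Qed.

Definition loop_map p : loop R y :=
  mk_path (@loop_map_continuous p) (loop_map_zero p) (loop_map_one p).

Lemma loop_mapE p t : loop_fun (loop_map p) t = f (loop_fun p t).
Proof. by []. Qed.

Lemma loop_map_homotopic p q :
  homotopic p q -> homotopic (loop_map p) (loop_map q).
Proof.
move=> [H [cH H0 H1 Hz Ho]]; exists (f \o H); split.
- by move=> w; apply: continuous_comp; [exact: cH|exact: cf].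
- by move=> t; rewrite /= H0.
- by move=> t; rewrite /= H1.
- by move=> s; rewrite /= Hz.
- by move=> s; rewrite /= Ho.
Qed.

Definition pi1_map (u : pi1 R x) : pi1 R y := loop_class (loop_map (repr u)).

Lemma pi1_map_class p : pi1_map (loop_class p) = loop_class (loop_map p).
Proof. exact/loop_classP/loop_map_homotopic/repr_loop_class. Qed.

Lemma pi1_map_morphism :
  (pi1_map 1 = 1)%g * {morph pi1_map : u v / (u * v)%g}.
Proof.
split=> [|u v].
  rewrite -loop_class1 pi1_map_class -loop_class1; congr loop_class.
  by apply: loop_eq => t; rewrite loop_mapE !loop_ofE.
have [p ->] := loop_class_surj u; have [q ->] := loop_class_surj v.
rewrite loop_classM !pi1_map_class loop_classM; congr loop_class.
apply: loop_eq => t; rewrite loop_mapE !loop_ofE /concat_fun.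
by case: ifP => _; rewrite /extend loop_mapE.
Qed.

HB.instance Definition _ :=
  isUMagmaMorphism.Build (pi1 R x) (pi1 R y) pi1_map pi1_map_morphism.

End InducedMorphism.

Section GroupLimit.
Variables (D : Type) (le : D -> D -> Prop) (P : D -> groupType).
Variable rho : forall s t, le t s -> {multiplicative P s -> P t}.

Definition compatible (g : forall s, P s) : Prop :=
  forall s t (ts : le t s), rho ts (g s) = g t.

Definition group_limit : Type := {g : forall s, P s | compatible g}.

Definition limit_proj (s : D) (g : group_limit) : P s := sval g s.

Lemma limit_eq (g h : group_limit) :
  (forall s, limit_proj s g = limit_proj s h) -> g = h.
Proof.
move=> gh; apply: eq_sig_hprop; first by move=> *; exact: Prop_irrelevance.
exact: functional_extensionality_dep.
Qed.

HB.instance Definition _ := gen_eqMixin group_limit.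
HB.instance Definition _ := gen_choiceMixin group_limit.

Lemma rho1 s t (ts : le t s) : rho ts 1%g = 1%g.
Proof. by apply: (mulgI (rho ts 1)%g); rewrite -gmulfM !mulg1. Qed.

Lemma compatible_one : compatible (fun=> 1%g).
Proof. by move=> s t ts; exact: rho1. Qed.

Lemma compatible_mul (g h : group_limit) :
  compatible (fun s => limit_proj s g * limit_proj s h)%g.
Proof.
by move=> s t ts; rewrite gmulfM; congr mul; [exact: (svalP g)|exact: (svalP h)].
Qed.

Lemma compatible_inv (g : group_limit) :
  compatible (fun s => (limit_proj s g)^-1)%g.
Proof.
move=> s t ts; apply: (mulgI (limit_proj t g)); rewrite mulgV.
by rewrite -[limit_proj t g](svalP g s t ts) -gmulfM mulgV rho1.
Qed.

Definition limit_one : group_limit := exist _ _ compatible_one.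
Definition limit_mul (g h : group_limit) : group_limit :=
  exist _ _ (compatible_mul g h).
Definition limit_inv (g : group_limit) : group_limit :=
  exist _ _ (compatible_inv g).

Lemma limit_mulA : associative limit_mul.
Proof. by move=> g h k; apply: limit_eq => s; exact: mulgA. Qed.

Lemma limit_mul1g : left_id limit_one limit_mul.
Proof. by move=> g; apply: limit_eq => s; exact: mul1g. Qed.

Lemma limit_mulg1 : right_id limit_one limit_mul.
Proof. by move=> g; apply: limit_eq => s; exact: mulg1. Qed.

Lemma limit_mulVg : left_inverse limit_one limit_inv limit_mul.
Proof. by move=> g; apply: limit_eq => s; exact: mulVg. Qed.

Lemma limit_mulgV : right_inverse limit_one limit_inv limit_mul.
Proof. by move=> g; apply: limit_eq => s; exact: mulgV. Qed.

HB.instance Definition _ := isGroup.Build group_limit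
  limit_mulA limit_mul1g limit_mulg1 limit_mulVg limit_mulgV.

End GroupLimit.

Record sgraph (V : finType) := SGraph {
  adj :> rel V;
  adj_sym : symmetric adj;
  adj_irr : irreflexive adj
}.

Section Graphs.
Variables (V : finType) (G : sgraph V).

Definition is_cycle (c : seq V) : bool :=
  [&& (3 <= size c)%N, cycle G c & uniq c].

(* An edge joining two vertices of [c] and distinct from all the edges
   {z, next c z} of the cycle. *)
Definition is_chord (c : seq V) (v w : V) : bool :=
  [&& v \in c, w \in c, G v w
    & [forall z in c, [set v; w]%SET != [set z; next c z]%SET]].

Definition chordal : Prop :=
  forall c, is_cycle c -> (4 <= size c)%N -> exists v w, is_chord c v w.

Definition simplex (S : {set V}) : bool :=
  [forall s in S, forall s' in S, (s != s') ==> G s s'].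

Definition simplices : Type := {S : {set V} | simplex S && (S != finset.set0)}.

End Graphs.

Section CompleteGraph.
Variable V : finType.

Lemma neq_sym : symmetric (fun v w : V => v != w).
Proof. by move=> v w; rewrite eq_sym. Qed.

Lemma neq_irr : irreflexive (fun v w : V => v != w).
Proof. by move=> v; rewrite eqxx. Qed.

Definition complete_graph : sgraph V := SGraph neq_sym neq_irr.

End CompleteGraph.

(* The field of complex numbers, with the topology given by the modulus. *)
Notation Cplx R := (R[i])^o.

Definition arrangement_complement (R : realType) (V : finType) (G : sgraph V) :
    set {ptws V -> Cplx R} :=
  [set x | forall i j, G i j -> x i <> x j].

Arguments arrangement_complement R {V} G.

Definition Xspace (R : realType) (V : finType) (G : sgraph V) : topologicalType :=
  arrangement_complement R G.

Section BasePoints.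
Variables (R : realType) (V : finType).

Definition basepoint : Type := {b : V -> Cplx R | injective b}.

Lemma base_subproof (G : sgraph V) (b : basepoint) :
  (sval b : {ptws V -> Cplx R}) \in arrangement_complement R G.
Proof.
apply/mem_set => i j Gij /(svalP b) ij.
by move: Gij; rewrite ij adj_irr.
Qed.

Definition base (G : sgraph V) (b : basepoint) : Xspace R G :=
  @exist _ (fun x => x \in arrangement_complement R G) _ (base_subproof G b).

Definition Gamma (G : sgraph V) (b : basepoint) : groupType :=
  pi1 R (base G b).

End BasePoints.

Lemma ptws_continuous (I : Type) (Z Y : topologicalType)
    (g : Z -> {ptws I -> Y}) :
  (forall i, continuous (fun z => g z i)) -> continuous g.
Proof.
move=> cg z; apply/cvg_sup => i.
exact: (@continuous_comp_initial _ _ _ (fun h : {ptws I -> Y} => h i) g (cg i)).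
Qed.

Lemma ptws_eval_continuous (I : eqType) (Y : topologicalType) (i : I) :
  continuous (fun h : {ptws I -> Y} => h i).
Proof. exact: (@proj_continuous I (fun=> Y) i). Qed.

Section Pullback.
Variables (R : realType) (V W : finType) (G : sgraph V) (H : sgraph W).
Variables (f : W -> V) (fH : forall i j, H i j -> G (f i) (f j)).

Definition coord (x : Xspace R G) : {ptws V -> Cplx R} := set_val x.

Lemma coord_continuous : continuous coord.
Proof. exact: initial_continuous. Qed.

Lemma pullback_subproof (x : Xspace R G) :
  ((fun i => coord x (f i)) : {ptws W -> Cplx R}) \in arrangement_complement R H.
Proof.
by apply/mem_set => i j /fH ij; case: x => x hx; exact: (set_mem hx _ _ ij).
Qed.

Definition pullback (x : Xspace R G) : Xspace R H :=
  @exist _ (fun x => x \in arrangement_complement R H) _ (pullback_subproof x).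

Lemma pullback_continuous : continuous pullback.
Proof.
apply: continuous_comp_initial; apply: ptws_continuous => i x.
apply: (@continuous_comp _ _ _ coord (fun h => h (f i))).
  exact: coord_continuous.
exact: ptws_eval_continuous.
Qed.

Lemma pullback_base (b : basepoint R V) (c : basepoint R W) :
  (forall i, sval c i = sval b (f i)) -> pullback (base G b) = base H c.
Proof.
move=> bc; apply: val_inj; apply/funext => i; exact/esym/bc.
Qed.

End Pullback.

Section ColoredBraids.
Variables (R : realType) (V : finType) (b : basepoint R V).

Notation vertices S := {v : V | v \in S}.

Lemma base_restrict_inj (S : {set V}) :
  injective (fun v : vertices S => sval b (val v)).
Proof. by move=> v w /(svalP b)/val_inj. Qed.

Definition base_restrict (S : {set V}) : basepoint R (vertices S) :=
  exist _ _ (@base_restrict_inj S).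

Definition P (S : {set V}) : groupType :=
  Gamma (complete_graph (vertices S)) (base_restrict S).

Section Rho.
Variables (J I : {set V}) (JI : J \subset I).

Definition vertices_incl (v : vertices J) : vertices I :=
  exist _ (val v) (fintype.subsetP JI _ (valP v)).

Lemma vertices_incl_edge (v w : vertices J) :
  complete_graph (vertices J) v w ->
  complete_graph (vertices I) (vertices_incl v) (vertices_incl w).
Proof. by apply: contra => /eqP[/val_inj ->]. Qed.

Definition rho : {multiplicative P I -> P J} :=
  pi1_map (@pullback_continuous R _ _ _ _ _ vertices_incl_edge)
    (@pullback_base R _ _ _ _ _ vertices_incl_edge (base_restrict I)
       (base_restrict J) (fun=> erefl)).

End Rho.

Lemma rho_id (I : {set V}) (II : I \subset I) (g : P I) : rho II g = g.
Proof.
have [p ->] := loop_class_surj g; rewrite /rho /= pi1_map_class.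
congr loop_class; apply: loop_eq => t; rewrite loop_mapE; apply: val_inj.
apply/funext => v; apply: (congr1 (coord (loop_fun p t))).
exact: val_inj.
Qed.

Lemma rho_comp (K J I : {set V}) (KJ : K \subset J) (JI : J \subset I)
    (KI : K \subset I) (g : P I) :
  rho KJ (rho JI g) = rho KI g.
Proof.
have [p ->] := loop_class_surj g; rewrite /rho /= !pi1_map_class.
congr loop_class; apply: loop_eq => t; rewrite !loop_mapE; apply: val_inj.
apply/funext => v; apply: (congr1 (coord (loop_fun p t))).
exact: val_inj.
Qed.

Variable G : sgraph V.

Definition simplex_le (T S : simplices G) : Prop := val T \subset val S.

Definition lim_P : groupType :=
  @group_limit (simplices G) simplex_le (fun S => P (val S))
    (fun S T TS => rho TS).

Section Restriction.
Variable S : simplices G.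

Lemma simplex_edge (v w : vertices (val S)) :
  complete_graph (vertices (val S)) v w -> G (val v) (val w).
Proof.
move=> vw; have /andP[/forall_inP/(_ _ (valP v))] := valP S.
by move=> /forall_inP/(_ _ (valP w))/implyP + _; apply.
Qed.

(* [simplex_edge] makes the coordinate projection X(G) -> X(C_S) well defined. *)
Definition res : {multiplicative Gamma G b -> P (val S)} :=
  pi1_map (@pullback_continuous R _ _ _ _ _ simplex_edge)
    (@pullback_base R _ _ _ _ _ simplex_edge b (base_restrict (val S))
       (fun=> erefl)).

End Restriction.

Lemma res_compatible (S T : simplices G) (TS : simplex_le T S) (g : Gamma G b) :
  rho TS (res S g) = res T g.
Proof.
have [p ->] := loop_class_surj g; rewrite /rho /res /= !pi1_map_class.
by congr loop_class; apply: loop_eq => t; rewrite !loop_mapE; exact: val_inj.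
Qed.

End ColoredBraids.

(* Main.v *)
From HB Require Import structures.
From mathcomp Require Import all_boot all_order all_algebra.
From mathcomp Require Import generic_quotient monoid complex.
From mathcomp Require Import mathcomp_extra boolp classical_sets functions.
From mathcomp Require Import set_interval reals topology normedtype homotopy.
From mathcomp Require Import lra.
Require Import Defs.

(** Restricting braids to the simplices of [G] gives a homomorphism from
    [Gamma G] to the limit, and the content of the theorem is that it is
    bijective when [G] is chordal.

    By Dirac, every induced subgraph of a chordal graph has a simplicial vertex
    [v], one whose neighbours form a clique [K] ([exists_simplicial]); so the
    theorem follows by induction if it survives adding such a vertex.  Forgetting
    the coordinate [v] makes the configuration space of the larger graph the
    pullback, along the projection to [X(C_K)], of the map
    [X(C_(K + v)) -> X(C_K)], whose fibre is the plane minus the points indexed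
    by [K].  This map is a fibration and has a section, which puts the strand [v]
    near infinity; the two halves of the induction draw on these facts.

    - Surjectivity ([glue_strands]).  The given braids on the smaller graph and
      on [K + v] restrict to homotopic braids on [K].  Lifting this homotopy to
      the strand [v] makes the restrictions equal, and the two loops then glue.

    - Injectivity ([null_strands]).  A null homotopy on the smaller graph lifts
      to the strand [v] and leaves a loop moving only [v], that is, a loop in the
      fibre.  It remains to see that the fundamental group of the fibre embeds
      in that of [X(C_(K + v))] ([one_strand_null]).  Usually this follows from
      the section and the long exact sequence; here the null homotopy is
      transported back to the fibre, which leaves an error that is a loop of
      transformations of the plane applied to [v].  These transformations are
      trivial far away, so the error dies once [v] is moved to infinity.

    The only analytic input is [transport]: over a compact parameter space, a
    path of configurations of finitely many points extends to a family of
    injections of the plane, trivial far from the points and trivial when the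
    path is constant.  Time is cut into steps so short that each one is realised
    by adding to the identity a Lipschitz map of constant less than 1.

    Loops of configurations are handled as families of strands, one arc in the
    plane for each vertex ([isotopic]).  Braids on different vertex sets can then
    be compared over the same [V], a vertex without edges being unconstrained. *)

Set Implicit Arguments.
Unset Strict Implicit.
Unset Printing Implicit Defensive.

Import Order.TTheory GRing.Theory Num.Theory.
Import numFieldNormedType.Exports.

Local Open Scope classical_set_scope.
Local Open Scope ring_scope.

Import ComplexField.Normc.

(** * The modulus on the complex numbers *)

Section Modulus.
Variable R : realType.
Local Notation C := (Cplx R).

Lemma normC_normc (z : C) : `|z| = (normc z)%:C%C.
Proof. by case: z. Qed.

Lemma normc_ge0 (z : C) : 0 <= normc z.
Proof. by case: z => a b; exact: sqrtr_ge0. Qed.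

Lemma normc_triangle (x y : C) : normc (x + y) <= normc x + normc y.
Proof. exact: le_normcD. Qed.

Lemma normc_opp (x : C) : normc (- x) = normc x.
Proof. exact: normcN. Qed.

Lemma normc_dist_sym (x y : C) : normc (x - y) = normc (y - x).
Proof. by rewrite -normc_opp opprB. Qed.

Lemma normc_real (r : R) : normc r%:C%C = `|r|.
Proof. by rewrite /= expr0n addr0 sqrtr_sqr. Qed.

Lemma normc_sum (I : finType) (F : I -> C) :
  normc (\sum_i F i) <= \sum_i normc (F i).
Proof.
elim/big_ind2 : _ => [|x x' y y' lx ly|//]; first by rewrite normc0.
by apply: le_trans (normc_triangle _ _) _; exact: lerD.
Qed.

Lemma dist_normc (x y : C) : `|normc x - normc y| <= normc (x - y).
Proof.
have h (u v : C) : normc u - normc v <= normc (u - v).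
  by rewrite lerBlDr; apply: le_trans (normc_triangle _ _); rewrite subrK.
by rewrite ler_norml h andbT lerNl opprB normc_dist_sym; exact: h.
Qed.

Lemma normc_gt0 (x y : C) : x <> y -> 0 < normc (x - y).
Proof.
move=> xy; rewrite lt_neqAle normc_ge0 andbT; apply/eqP => /esym/eq0_normc.
by move/eqP; rewrite subr_eq0 => /eqP.
Qed.

(** The norm of a complex number is again a complex number; the estimates below
    compare real moduli. *)
Lemma cvg_normcP (T : Type) (F : set_system T) (FF : Filter F)
    (f : T -> C) (l : C) :
  (f @ F --> l) <-> forall e : R, 0 < e ->
    \forall t \near F, normc (l - f t) < e.
Proof.
split=> [fl e e0|h].
  have ee : 0 < e%:C%C :> C by rewrite ltcR.
  near=> t; rewrite -ltcR -normC_normc; near: t.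
  by move/cvgrPdist_lt: fl; apply.
apply/cvgrPdist_lt => e e0.
have /complex_realP[r er] : (e : R[i]) \is Num.real by exact: gtr0_real.
subst e.
have r0 : 0 < r by move: e0; rewrite ltcR.
near=> t; rewrite normC_normc ltcR; near: t; exact: h.
Unshelve. all: by end_near. Qed.

Lemma normc_continuous : continuous (@normc R : C -> R).
Proof.
move=> z; apply/(@cvgrPdist_lt _ R^o _ _ (nbhs_filter (z : C))) => e e0.
near=> y; apply: le_lt_trans (dist_normc _ _) _; near: y.
by move: e e0; apply/(cvg_normcP (nbhs_filter z)); exact: cvg_id.
Unshelve. all: by end_near. Qed.

Lemma real_complex_continuous : continuous (fun r : R => r%:C%C : C).
Proof.
move=> r; apply/(cvg_normcP (nbhs_filter r)) => e e0.
near=> s; rewrite -rmorphB normc_real; near: s.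
by move: e e0; apply/cvgrPdist_lt; exact: cvg_id.
Unshelve. all: by end_near. Qed.

End Modulus.

(** * Pushing finitely many points of the plane *)

Section Push.
Variable R : realType.
Local Notation C := (Cplx R).

Definition bump (e : R) (z : C) : R := Num.max 0 (1 - normc z / e).

Lemma bump0 e : bump e 0 = 1.
Proof. by rewrite /bump normc0 mul0r subr0 max_r. Qed.

Lemma bump_far e z : 0 < e -> e <= normc z -> bump e z = 0.
Proof.
by move=> e0 ez; apply: max_l; rewrite subr_le0 ler_pdivlMr// mul1r.
Qed.

Lemma bump_lipschitz e y z : 0 < e ->
  `|bump e y - bump e z| <= normc (y - z) / e.
Proof.
move=> e0.
have h (a b : R) : `|Num.max 0 a - Num.max 0 b| <= `|a - b|.
  have := ler_norm (a - b); have := ler_norm (b - a); rewrite distrC ler_norml.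
  by case: (leP 0 a); case: (leP 0 b) => ? ? ? ?; apply/andP; split; lra.
apply: le_trans (h _ _) _.
have -> : 1 - normc y / e - (1 - normc z / e) = (normc z - normc y) / e.
  by rewrite mulrBl; lra.
rewrite normrM.
have ei : 0 <= e^-1 by rewrite invr_ge0 ltW.
by rewrite [`|e^-1|]ger0_norm// ler_wpM2r// distrC dist_normc.
Qed.

Lemma bump_continuous e : continuous (bump e).
Proof.
have ch : continuous ((fun=> 0 : R) \max (fun r : R => - e^-1 * r + 1)).
  apply: max_fun_continuous; first by move=> ?; exact: cvg_cst.
  by apply: affine_continuous => ?; exact: cvg_id.
move=> z; have -> : bump e = ((fun=> 0 : R) \max (fun r : R => - e^-1 * r + 1))
    \o @normc R.
  by apply/funext => y; rewrite /bump /= mulNr addrC mulrC.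
by apply: continuous_comp; [exact: normc_continuous|exact: ch].
Qed.

Section Fixed.
Variables (I : finType) (e : R) (e0 : 0 < e).

(** Moves each [a i] to [a' i] and fixes every point at distance at least [e]
    from all the [a i]. *)
Definition push (a a' : I -> C) (z : C) : C :=
  z + \sum_i (bump e (z - a i))%:C%C * (a' i - a i).

(** The displacement is Lipschitz of constant less than 1, as the bump functions
    are Lipschitz of constant [1 / e]; two points with the same image would thus
    be at a distance less than itself. *)
Lemma push_inj a a' : \sum_i normc (a' i - a i) < e -> injective (push a a').
Proof.
move=> small y z yz; apply/eqP; rewrite -subr_eq0; apply/negPn/negP => yz0.
have nyz : 0 < normc (y - z).
  by apply: normc_gt0 => yz'; move: yz0; rewrite yz' subrr eqxx.
have yzE : y - z =
    \sum_i (bump e (z - a i) - bump e (y - a i))%:C%C * (a' i - a i).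
  have := yz; rewrite /push => /eqP; rewrite -subr_eq0 opprD addrACA.
  rewrite addr_eq0 => /eqP ->; rewrite opprB -sumrB.
  by apply: eq_bigr => i _; rewrite rmorphB mulrBl.
have : normc (y - z) <= normc (y - z) * ((\sum_i normc (a' i - a i)) / e).
  rewrite {1}yzE; apply: le_trans (normc_sum _) _.
  rewrite mulrA mulrAC mulr_sumr; apply: ler_sum => i _; rewrite normcM.
  rewrite normc_real; apply: ler_wpM2r; first exact: normc_ge0.
  apply: le_trans (bump_lipschitz _ _ e0) _.
  by rewrite opprB addrA subrK normc_dist_sym.
rewrite ler_pMr// leNgt => /negP; apply.
by rewrite ltr_pdivrMr ?mul1r.
Qed.

(** Points [e]-apart do not see the bumps of one another. *)
Lemma push_at a a' k : (forall i j, i != j -> e <= normc (a i - a j)) ->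
  push a a' (a k) = a' k.
Proof.
move=> far; rewrite /push (bigD1 k)//= subrr bump0 mul1r big1 => [|i ik].
  by rewrite addr0 addrC subrK.
by rewrite bump_far ?mul0r// far// eq_sym.
Qed.

Lemma push_fix a a' z : (forall i, a' i = a i) -> push a a' z = z.
Proof.
by move=> aa; rewrite /push big1 ?addr0// => i _; rewrite aa subrr mulr0.
Qed.

Lemma push_far a a' z : (forall i, e <= normc (z - a i)) -> push a a' z = z.
Proof.
by move=> far; rewrite /push big1 ?addr0// => i _; rewrite bump_far// mul0r.
Qed.

Lemma push_continuous (W : topologicalType) (a a' : W -> I -> C) (f : W -> C) :
  (forall i, continuous (a ^~ i)) -> (forall i, continuous (a' ^~ i)) ->
  continuous f -> continuous (fun w => push (a w) (a' w) (f w)).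
Proof.
move=> ca ca' cf w; apply: (@cvgD _ C); first exact: cf.
apply: cvg_big => [|i _].
  exact: (@add_continuous C).
apply: (@cvgM R[i]); last by apply: (@cvgB _ C); [exact: ca'|exact: ca].
apply: (@continuous_comp _ _ _ (fun w => bump e (f w - a w i))
  (fun r : R => r%:C%C : C)); last exact: real_complex_continuous.
apply: (@continuous_comp _ _ _ (fun w => f w - a w i) (bump e)).
  by apply: (@cvgB _ C); [exact: cf|exact: ca].
exact: bump_continuous.
Qed.

End Fixed.
End Push.

(** * Transporting the plane along a moving configuration *)

Section Transport.
Variables (R : realType) (W : topologicalType) (cW : compact [set: W]).
Local Notation C := (Cplx R).
Variables (I : finType) (h : I -> R * W -> C).
Hypothesis ch : forall i, continuous (h i).
Hypothesis h_neq : forall u w i j, 0 <= u <= 1 -> i != j ->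
  h i (u, w) <> h j (u, w).

Let A : set (R * W) := `[0, 1]%classic `*` [set: W].

Let A_in u w : 0 <= u <= 1 -> A (u, w).
Proof. by move=> u01; split => //=; rewrite in_itv. Qed.

Let cA : compact A.
Proof. exact: compact_setX (@segment_compact _ _ _) cW. Qed.

Lemma transport_separation : exists2 e : R, 0 < e &
  forall u w i j, 0 <= u <= 1 -> i != j -> e <= normc (h i (u, w) - h j (u, w)).
Proof.
suff : \forall e \near (0:R)^'+, forall i j x, A x -> i != j ->
    e < normc (h i x - h j x).
  move=> H; have [e [e0 He]] : exists e : R, 0 < e /\ forall i j x, A x ->
      i != j -> e < normc (h i x - h j x).
    near (0:R)^'+ => e; exists e; split; first by [].
    by near: e.
  by exists e => // u w i j u01 ij; apply/ltW/He => //; exact: A_in.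
apply: filter_forall => i; apply: filter_forall => j.
have [<-|ij] := eqVneq i j; first by apply: nearW.
suff : \forall e \near (0:R)^'+, forall x, A x -> e < normc (h i x - h j x).
  by apply: filterS => e He x Ax _; exact: He.
apply: (iffLR (compact_near_coveringP A) cA R _
  (fun e x => e < normc (h i x - h j x))) => -[u w] [/= u01 _].
set x0 := (u, w).
have d0 : 0 < normc (h i x0 - h j x0).
  by apply/normc_gt0/h_neq => //; move: u01; rewrite in_itv.
have cn : continuous (fun x => normc (h i x - h j x)).
  move=> x; apply: (@continuous_comp _ _ _ (fun x => h i x - h j x)).
    by apply: (@cvgB _ C); exact: ch.
  exact: normc_continuous.
near=> x e => /=; apply: (@lt_trans _ _ (normc (h i x0 - h j x0) / 2)).
  by near: e; apply: nbhs_right_lt; rewrite divr_gt0.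
near: x; apply: (cn x0 [set r | normc (h i x0 - h j x0) / 2 < r]).
apply: open_nbhs_nbhs; split; first exact: open_gt.
by rewrite /= ltr_pdivrMr// ltr_pMr// ltr1n.
Unshelve. all: by end_near. Qed.

(** Heine's theorem in the time variable only, as [W] carries no uniform
    structure. *)
Lemma transport_uniform (e : R) : 0 < e -> exists2 d : R, 0 < d &
  forall u v w i, 0 <= u <= 1 -> `|u - v| < d ->
    normc (h i (v, w) - h i (u, w)) < e.
Proof.
move=> e0.
suff : \forall d \near (0:R)^'+, forall i x, A x ->
    forall v, `|x.1 - v| < d -> normc (h i (v, x.2) - h i x) < e.
  move=> H; near (0:R)^'+ => d; exists d => // u v w i u01 uv.
  have : forall i x, A x ->
    forall v, `|x.1 - v| < d -> normc (h i (v, x.2) - h i x) < e by near: d.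
  by move/(_ i _ (A_in w u01) v uv).
apply: filter_forall => i.
apply: (iffLR (compact_near_coveringP A) cA (R) _ (fun d x =>
   forall v, `|x.1 - v| < d -> normc (h i (v, x.2) - h i x) < e))
   => -[u w] [/= u01 _].
have near_h : \forall x \near (u, w), normc (h i (u, w) - h i x) < e / 2.
  by move: (e / 2) (divr_gt0 e0 (ltr0n R 2)) => e' ?;
    apply: (iffLR (cvg_normcP (nbhs_filter (u, w)) _ _)); [exact: ch|].
case: near_h => -[U1 U2] /= [U1u U2w] U12.
case/nbhs_ballP: U1u => r r0 rU.
have r2 : 0 < r / 2 by rewrite divr_gt0.
have nb : \forall x \near (u, w), `|u - x.1| < r / 2 /\ U2 x.2.
  exists (ball u (r / 2), U2) => //=.
  by split => //; exact: nbhsx_ballx.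
near=> x d => v /= xv.
have e2 : e = e / 2 + e / 2 by lra.
have -> : h i (v, x.2) - h i x =
    (h i (u, w) - h i x) - (h i (u, w) - h i (v, x.2)).
  by rewrite opprB [RHS]addrC addrA subrK.
apply: le_lt_trans (normc_triangle _ _) _; rewrite normc_opp e2.
have [xr x2] : `|u - x.1| < r / 2 /\ U2 x.2 by near: x.
have dr : d < r / 2 by near: d; exact: nbhs_right_lt.
apply: ltrD; apply: U12; split => //=; apply: rU; rewrite /ball /=; first by lra.
apply: le_lt_trans (ler_distD x.1 _ _) _; lra.
Unshelve. all: by end_near. Qed.

Lemma transport_bounded : exists M : R, forall u w i,
  0 <= u <= 1 -> normc (h i (u, w)) <= M.
Proof.
suff : \forall M \near +oo, forall i x, A x -> normc (h i x) < M.
  move=> H; near (+oo:set_system R) => M; exists M => u w i u01.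
  have : forall i x, A x -> normc (h i x) < M by near: M.
  by move/(_ i _ (A_in w u01))/ltW.
apply: filter_forall => i.
apply: (iffLR (compact_near_coveringP A) cA R _
  (fun M x => normc (h i x) < M)) => x _.
near=> y M => /=; apply: (@lt_trans _ _ (normc (h i x) + 1)).
  near: y.
  have cn : continuous (fun x => normc (h i x)).
    move=> z; apply: (@continuous_comp _ _ _ (h i)); first exact: ch.
    exact: normc_continuous.
  apply: (cn x [set r | r < normc (h i x) + 1]).
  by apply: open_nbhs_nbhs; split; [exact: open_lt|rewrite /= ltrDl].
by near: M; apply: nbhs_pinfty_gt; rewrite num_real.
Unshelve. all: by end_near. Qed.

(** A parametrized isotopy extension theorem.  Injectivity is all that is asked
    of the maps [phi (w, _)], because it already keeps every point off the moving
    ones.  The last two properties are what make lifts relative to the ends of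
    an arc, and the section near infinity, available. *)
Lemma transport : exists phi : W * C -> C, [/\ continuous phi,
    forall w, injective (fun z => phi (w, z)),
    forall w i, phi (w, h i (0, w)) = h i (1, w),
    forall w z, (forall u i, 0 <= u <= 1 -> h i (u, w) = h i (0, w)) ->
      phi (w, z) = z
  & exists M : R, forall w z, M <= normc z -> phi (w, z) = z].
Proof.
have [e e0 sep] := transport_separation.
have [M bnd] := transport_bounded.
have [d d0 unif] : exists2 d : R, 0 < d & forall u v w, 0 <= u <= 1 ->
    `|u - v| < d -> \sum_i normc (h i (v, w) - h i (u, w)) < e.
  (* the points move by less than e in total *)
  have e1 : 0 < e / (#|I|.+1)%:R by rewrite divr_gt0.
  have [d d0 Hd] := transport_uniform e1; exists d => // u v w u01 uv.
  apply: (@le_lt_trans _ _ (\sum_(i : I) e / (#|I|.+1)%:R)).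
    by apply: ler_sum => i _; apply/ltW/Hd.
  rewrite sumr_const -[_ *+ _]mulr_natr -mulrA gtr_pMr// mulrC.
  by rewrite ltr_pdivrMr// mul1r ltr_nat.
have [N Nd] : exists N : nat, N.+1%:R^-1 < d.
  have [N _ /(_ N (leqnn _)) Nd] := near_infty_natSinv_lt
    (interval_inference.PosNum d0).
  by exists N.
pose t (k : nat) : R := k%:R / N.+1%:R.
have t01 k : (k <= N.+1)%N -> 0 <= t k <= 1.
  by move=> kN; rewrite divr_ge0//= ler_pdivrMr// mul1r ler_nat.
suff H k : (k <= N.+1)%N -> exists phi : W * C -> C, [/\ continuous phi,
    forall w, injective (fun z => phi (w, z)),
    forall w i, phi (w, h i (0, w)) = h i (t k, w),
    forall w z, (forall u i, 0 <= u <= 1 -> h i (u, w) = h i (0, w)) ->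
      phi (w, z) = z
  & forall w z, M + e <= normc z -> phi (w, z) = z].
  have [phi [c inj at_ fix_ far]] := H _ (leqnn _).
  exists phi; split => //; last by exists (M + e).
  by move=> w i; rewrite at_ /t divff// pnatr_eq0.
elim: k => [_|k IH kN].
  exists snd; split => //.
  - exact: snd_continuous.
  - by move=> w x y.
  - by move=> w i; rewrite /t mul0r.
have [phi [c inj at_ fix_ far]] := IH (ltnW kN).
have h_cont u i : continuous (fun x : W * C => h i (u, x.1)).
  move=> x; apply: (@continuous_comp _ _ _ (fun x : W * C => (u, x.1)) (h i)).
    apply: pair_continuous; last exact: fst_continuous.
    by move=> ?; exact: cvg_cst.
  exact: ch.
exists (fun x => push e (fun i => h i (t k, x.1)) (fun i => h i (t k.+1, x.1))
   (phi x)); split.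
- by apply: push_continuous => // i; exact: h_cont.
- move=> w y z /= /push_inj yz; apply: (inj w); apply: yz => //.
  apply: unif; first exact: t01 (ltnW kN).
  rewrite distrC /t -mulrBl -natrB// subSnn mul1r gtr0_norm//.
  by rewrite invr_gt0.
- move=> w i; rewrite at_; apply: push_at => // j l jl.
  by apply: sep => //; exact: t01 (ltnW kN).
- move=> w z hw; rewrite fix_//; apply: push_fix => i.
  by rewrite !hw// t01// ltnW.
- move=> w z Mz; rewrite far//; apply: push_far => // i.
  have := bnd (t k) w i (t01 _ (ltnW kN)).
  have := dist_normc z (h i (t k, w)).
  rewrite ler_norml => /andP[_]; lra.
Qed.
End Transport.

(** * Loops of configurations as families of strands *)

Section Squares.
Variable R : realType.
Local Notation C := (Cplx R).
Local Notation I := (unitI R).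
Local Notation val := (@unitI_val R).

Definition arc (x : C) (f : I -> C) : Prop :=
  [/\ continuous f, f zero = x & f one = x].

(** A homotopy from [f] to [g] with both ends of the arcs kept at [x]; the first
    coordinate is the time of the homotopy. *)
Definition square (x : C) (f g : I -> C) (H : I * I -> C) : Prop :=
  [/\ continuous H, forall t, H (zero, t) = f t, forall t, H (one, t) = g t,
      forall s, H (s, zero) = x & forall s, H (s, one) = x].

Lemma slice_continuous (T U Y : topologicalType) (H : T * U -> Y) t :
  continuous H -> continuous (fun u => H (t, u)).
Proof.
move=> cH u; apply: (@continuous_comp _ _ _ (fun u => (t, u)) H); last exact: cH.
by apply: pair_continuous => ?; [exact: cvg_cst|exact: cvg_id].
Qed.

Lemma square_arcl x f g H : square x f g H -> arc x f.
Proof.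
move=> [cH H0 _ Hz Ho]; split; rewrite -?H0 ?Hz ?Ho//.
by rewrite -(_ : (fun t => H (zero, t)) = f) ?funeqE//; exact: slice_continuous.
Qed.

Lemma square_arcr x f g H : square x f g H -> arc x g.
Proof.
move=> [cH _ H1 Hz Ho]; split; rewrite -?H1 ?Hz ?Ho//.
by rewrite -(_ : (fun t => H (one, t)) = g) ?funeqE//; exact: slice_continuous.
Qed.

Lemma arc_cst x : arc x (fun=> x).
Proof. by split=> //; exact: cst_continuous. Qed.

Lemma square_line x f g : arc x f -> arc x g -> square x f g
  (fun w => f w.2 + (val w.1)%:C%C * (g w.2 - f w.2)).
Proof.
move=> [cf f0 f1] [cg g0 g1]; split.
- have c2 (k : I -> C) : continuous k -> continuous (fun w : I * I => k w.2).
    move=> ck w; apply: (@continuous_comp _ _ _ snd k); last exact: ck.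
    exact: snd_continuous.
  move=> w; apply: (@cvgD _ C); first exact: (c2 _ cf).
  apply: (@cvgM R[i]); last first.
    by apply: (@cvgB _ C); [exact: (c2 _ cg)|exact: (c2 _ cf)].
  apply: (@continuous_comp _ _ _ (fun w => val w.1) (fun r : R => r%:C%C : C));
    last exact: real_complex_continuous.
  apply: (@continuous_comp _ _ _ fst val); first exact: fst_continuous.
  exact: unitI_val_continuous.
- by move=> t /=; rewrite val0 mul0r addr0.
- by move=> t /=; rewrite val1 mul1r addrC subrK.
- by move=> s /=; rewrite f0 g0 subrr mulr0 addr0.
- by move=> s /=; rewrite f1 g1 subrr mulr0 addr0.
Qed.

End Squares.

Section Strands.
Variables (R : realType) (V : finType) (b : basepoint R V).
Local Notation C := (Cplx R).
Local Notation I := (unitI R).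
Local Notation val := (@unitI_val R).
Implicit Types (e : sgraph V) (f g k : V -> I -> C).

Definition avoids (e : rel V) (T : Type) (F : V -> T -> C) : Prop :=
  forall w i j, e i j -> F i w <> F j w.

Definition strand_loop e f : Prop :=
  (forall i, arc (sval b i) (f i)) /\ avoids e f.

(** Based homotopy in [X(e)], read coordinate by coordinate; see
    [homotopic_isotopic]. *)
Definition isotopic e f g : Prop :=
  exists2 H : V -> I * I -> C,
    forall i, square (sval b i) (f i) (g i) (H i) & avoids e H.

Lemma isotopic_loopl e f g : isotopic e f g -> strand_loop e f.
Proof.
move=> [H sH aH]; split=> [i|t i j ij]; first exact: square_arcl (sH i).
by have [_ <- _ _ _] := sH i; have [_ <- _ _ _] := sH j; exact: aH.
Qed.

Lemma isotopic_loopr e f g : isotopic e f g -> strand_loop e g.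
Proof.
move=> [H sH aH]; split=> [i|t i j ij]; first exact: square_arcr (sH i).
by have [_ _ <- _ _] := sH i; have [_ _ <- _ _] := sH j; exact: aH.
Qed.

Lemma isotopic_sub e e' f g : subrel e' e -> isotopic e f g -> isotopic e' f g.
Proof. by move=> ee [H sH aH]; exists H => // w i j /ee; exact: aH. Qed.

(** A vertex outside [A] has no edge, so its strand is unconstrained and can be
    moved in a straight line, the plane being convex. *)
Lemma isotopic_local e (A : {set V}) f g (H : V -> I * I -> C) :
  (forall i j, e i j -> (i \in A) && (j \in A)) ->
  (forall i, arc (sval b i) (f i)) -> (forall i, arc (sval b i) (g i)) ->
  (forall i, i \in A -> square (sval b i) (f i) (g i) (H i)) ->
  avoids e H -> isotopic e f g.
Proof.
move=> eA af ag sH aH.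
exists (fun i => if i \in A then H i else
  fun w => f i w.2 + (val w.1)%:C%C * (g i w.2 - f i w.2)).
  by move=> i; case: ifPn => [/sH//|_]; exact: square_line.
by move=> w i j ij; have /andP[-> ->] := eA _ _ ij; exact: aH.
Qed.

Lemma isotopic_refl e f : strand_loop e f -> isotopic e f f.
Proof.
move=> [af avf]; exists (fun i w => f i w.2) => [i|w i j]; last exact: avf.
have [cf f0 f1] := af i; split=> // w.
by apply: (@continuous_comp _ _ _ snd (f i)); [exact: snd_continuous|exact: cf].
Qed.

Section Config.
Variables (e : sgraph V) (T : topologicalType) (F : V -> T -> C).
Hypotheses (cF : forall i, continuous (F i)) (aF : avoids e F).

Lemma config_subproof w :
  ((fun i => F i w) : {ptws V -> C}) \in @arrangement_complement R V e.
Proof. by apply/mem_set => i j; exact: aF. Qed.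

Definition config (w : T) : Xspace R e :=
  @exist _ (fun x => x \in @arrangement_complement R V e) _ (config_subproof w).

Lemma config_continuous : continuous config.
Proof. by apply: continuous_comp_initial; exact: ptws_continuous. Qed.

End Config.

Definition strands e (p : loop R (base e b)) (i : V) (t : I) : C :=
  coord (loop_fun p t) i.

Lemma coord_neq e (x : Xspace R e) i j : e i j -> coord x i <> coord x j.
Proof. by move=> ij; case: x => x hx; exact: (set_mem hx _ _ ij). Qed.

Lemma coord_fun_continuous e (T : topologicalType) (F : T -> Xspace R e) i :
  continuous F -> continuous (fun w => coord (F w) i).
Proof.
move=> cF w; apply: (@continuous_comp _ _ _ F (fun x => coord x i)).
  exact: cF.
apply: (@continuous_comp _ _ _ (@coord R V e) (fun h => h i)).
  exact: coord_continuous.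
exact: ptws_eval_continuous.
Qed.

Lemma coord_inj e (x y : Xspace R e) : coord x =1 coord y -> x = y.
Proof. by move=> xy; apply: val_inj; apply/funext. Qed.

Lemma strands_loop e (p : loop R (base e b)) : strand_loop e (strands p).
Proof.
split=> [i|t i j ij]; last exact: coord_neq.
split; first exact/coord_fun_continuous/loop_continuous.
  by rewrite /strands /loop_fun path_zero.
by rewrite /strands /loop_fun path_one.
Qed.

Lemma strands_surj e f : strand_loop e f ->
  exists p : loop R (base e b), strands p = f.
Proof.
move=> [af avf].
have cf i : continuous (f i) by case: (af i).
have c0 : config avf zero = base e b.
  by apply: coord_inj => i; case: (af i).
have c1 : config avf one = base e b.
  by apply: coord_inj => i; case: (af i).
by exists (mk_path (@config_continuous e _ f cf avf) c0 c1).
Qed.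

Lemma homotopic_isotopic e (p q : loop R (base e b)) :
  homotopic p q <-> isotopic e (strands p) (strands q).
Proof.
split=> [[H [cH H0 H1 Hz Ho]]|[H sH aH]].
  exists (fun i w => coord (H w) i) => [i|w i j ij]; last exact: coord_neq.
  split; first exact: coord_fun_continuous.
  - by move=> t; rewrite H0.
  - by move=> t; rewrite H1.
  - by move=> s; rewrite Hz.
  - by move=> s; rewrite Ho.
have cH i : continuous (H i) by case: (sH i).
exists (config aH); split; first exact: (config_continuous cH).
- by move=> t; apply: coord_inj => i; case: (sH i) => _ /(_ t).
- by move=> t; apply: coord_inj => i; case: (sH i) => _ _ /(_ t).
- by move=> t; apply: coord_inj => i; case: (sH i) => _ _ _ /(_ t).
- by move=> t; apply: coord_inj => i; case: (sH i) => _ _ _ _ /(_ t).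
Qed.

Lemma isotopic_sym e f g : isotopic e f g -> isotopic e g f.
Proof.
move=> fg; have [p pf] := strands_surj (isotopic_loopl fg).
have [q qg] := strands_surj (isotopic_loopr fg).
move: fg; rewrite -pf -qg => /homotopic_isotopic/homotopic_sym.
by move/homotopic_isotopic.
Qed.

Lemma isotopic_trans e f g k :
  isotopic e f g -> isotopic e g k -> isotopic e f k.
Proof.
move=> fg gk; have [p pf] := strands_surj (isotopic_loopl fg).
have [q qg] := strands_surj (isotopic_loopr fg).
have [r rk] := strands_surj (isotopic_loopr gk).
move: fg gk; rewrite -pf -qg -rk.
move=> /homotopic_isotopic pq /homotopic_isotopic qr.
exact/homotopic_isotopic/(homotopic_trans pq qr).
Qed.

End Strands.

(** * Lifting one strand over a motion of the others *)

Lemma continuous_comp_fun (S T U : topologicalType) (f : S -> T) (g : T -> U) :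
  continuous f -> continuous g -> continuous (fun x => g (f x)).
Proof. by move=> cf cg x; apply: continuous_comp; [exact: cf|exact: cg]. Qed.

Section Lifting.
Variable R : realType.
Local Notation C := (Cplx R).
Local Notation I := (unitI R).
Local Notation val := (@unitI_val R).

Lemma unitI_compact : compact [set: I].
Proof.
have -> : [set: I] = (@clamp R) @` `[0, 1]%classic.
  apply/seteqP; split=> // t _; exists (val t); last exact: unitI_valK.
  by rewrite /= in_itv /= unitI_ge0 unitI_le1.
apply: continuous_compact; last exact: segment_compact.
exact/continuous_subspaceT/clamp_continuous.
Qed.

Lemma square_compact : compact [set: I * I].
Proof. by rewrite -setXTT; apply: compact_setX; exact: unitI_compact. Qed.

Lemma val_fst_continuous : continuous (fun w : I * I => val w.1).
Proof.
move=> w; apply: (@continuous_comp _ _ _ fst val); first exact: fst_continuous.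
exact: unitI_val_continuous.
Qed.

Lemma val_snd_continuous : continuous (fun w : I * I => val w.2).
Proof.
move=> w; apply: (@continuous_comp _ _ _ snd val); first exact: snd_continuous.
exact: unitI_val_continuous.
Qed.

Lemma track_continuous (T : topologicalType) (F : I * I -> C) (a : T -> R)
    (t : T -> I) : continuous a -> continuous t -> continuous F ->
  continuous (fun x => F (clamp (a x), t x)).
Proof.
move=> ca ct cF x.
apply: (@continuous_comp _ _ _ (fun x => (clamp (a x), t x)) F); last exact: cF.
apply: pair_continuous ct _ => {}x.
by apply: continuous_comp; [exact: ca|exact: clamp_continuous].
Qed.

Variables (V : finType) (b : basepoint R V).

(** The homotopy lifting property of [X(C_(K + v)) -> X(C_K)]: at time [s] the
    plane is transported along the strands of [K] from time [0] to time [s], and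
    carries the strand [g] with it. *)
Lemma lift_strand (K : {set V}) (f f' : V -> I -> C) (F : V -> I * I -> C)
    (x : C) (g : I -> C) :
  (forall k, k \in K -> square (sval b k) (f k) (f' k) (F k)) ->
  (forall w, {in K &, forall i j, i != j -> F i w <> F j w}) ->
  arc x g -> (forall t k, k \in K -> f k t <> g t) ->
  exists g' Phi, square x g g' Phi /\
    forall w k, k \in K -> F k w <> Phi w.
Proof.
move=> sF neqF [cg g0 g1] fg.
pose h (k : {k : V | k \in K}) (y : R * (I * I)) : C :=
  F (sval k) (clamp (y.1 * val y.2.1), y.2.2).
have ch k : continuous (h k).
  apply: track_continuous.
  - move=> y; apply: cvgM; first exact: cvg_fst.
    apply: (@continuous_comp _ _ _ snd (fun w : I * I => val w.1)).
      exact: snd_continuous.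
    exact: val_fst_continuous.
  - move=> y; apply: (@continuous_comp _ _ _ snd snd); exact: snd_continuous.
  - by case: (sF _ (svalP k)).
have h_neq u w i j : 0 <= u <= 1 -> i != j -> h i (u, w) <> h j (u, w).
  move=> _ ij; apply: neqF; rewrite ?(svalP i) ?(svalP j)//.
have [phi [cphi inj at_ fix_ _]] := transport square_compact ch h_neq.
pose Phi (w : I * I) := phi (w, g w.2).
exists (fun t => Phi (one, t)), Phi; split; last first.
  move=> [s t] k kK; rewrite /Phi /=.
  have := at_ (s, t) (exist _ k kK); rewrite /h /= mul1r unitI_valK => <-.
  move/inj; rewrite mul0r -unitI_zeroE.
  by have [_ -> _ _ _] := sF k kK; exact: fg.
split=> //.
- move=> w; apply: (@continuous_comp _ _ _ (fun w => (w, g w.2)) phi);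
    last exact: cphi.
  apply: pair_continuous; first by move=> ?; exact: cvg_id.
  move=> y; apply: (@continuous_comp _ _ _ snd g); last exact: cg.
  exact: snd_continuous.
- by move=> t; apply: fix_ => u i _; rewrite /h /= val0 !mulr0.
- move=> s; rewrite /Phi /= g0; apply: fix_ => u k _; rewrite /h /=.
  by have [_ _ _ Fz _] := sF _ (svalP k); rewrite !Fz.
- move=> s; rewrite /Phi /= g1; apply: fix_ => u k _; rewrite /h /=.
  by have [_ _ _ _ Fo] := sF _ (svalP k); rewrite !Fo.
Qed.

Definition base_strands : V -> I -> C := fun u _ => sval b u.

(** Loops in the fibre over the base configuration. *)
Definition one_strand (v : V) (d : I -> C) : V -> I -> C :=
  fun u => if u == v then d else fun=> sval b u.

Lemma one_strand_isotopic (e : sgraph V) v d d' D :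
  square (sval b v) d d' D -> (forall w k, e v k -> sval b k <> D w) ->
  isotopic b e (one_strand v d) (one_strand v d').
Proof.
move=> sD aD; exists (fun u => if u == v then D else fun=> sval b u).
  move=> u; rewrite /one_strand; case: eqP => [->//|_].
  by split=> //; exact: cst_continuous.
move=> w i j; case: eqP => [->|_]; case: eqP => [->|_] ij.
- by rewrite adj_irr in ij.
- by move/esym; exact: aD.
- by apply: aD; rewrite adj_sym.
- by move/(svalP b) => ij'; rewrite ij' adj_irr in ij.
Qed.

(** Each other base point lies on one line through the base point of [v]; a line
    steeper than all of these that are not vertical avoids them. *)
Lemma escaping_ray (v : V) : exists2 d : C, 1 <= normc d &
  forall (r : R) k, k != v -> sval b k <> sval b v + r%:C%C * d.
Proof.
pose slope k := (complex.Im (sval b k) - complex.Im (sval b v)) /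
  (complex.Re (sval b k) - complex.Re (sval b v)).
pose m := 1 + \sum_k `|slope k|.
exists (1 +i* m)%C.
  rewrite /= -[X in X <= _]sqrtr1 ler_sqrt; last by rewrite addr_ge0 ?sqr_ge0.
  by rewrite expr1n lerDl sqr_ge0.
move=> r k kv bk.
have [Rk Ik] : complex.Re (sval b k) - complex.Re (sval b v) = r /\
    complex.Im (sval b k) - complex.Im (sval b v) = r * m.
  rewrite bk; case: (sval b v) => x y; split; simpc => /=; lra.
have r0 : r != 0.
  apply/eqP => r0; move: bk; rewrite r0 mul0r addr0 => /(svalP b) /eqP.
  by rewrite (negbTE kv).
have : slope k = m by rewrite /slope Rk Ik mulrAC divff// mul1r.
have : `|slope k| <= \sum_k `|slope k|.
  by rewrite (bigD1 k)//= lerDl sumr_ge0.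
by have := ler_norm (slope k); rewrite /m; lra.
Qed.

(** A loop in the fibre that is null homotopic in [X(C_(K + v))] is null homotopic
    in the fibre.  Transport along the null homotopy, run backwards, brings the
    strands of [K] back to their base points.  It turns the strand [v] of the null
    homotopy into a homotopy in the fibre from [d] to the loop [eta] traced by the
    base point of [v] under a loop of injections fixing the points of [K].  A base
    point that first runs out to where these injections are trivial traces a loop
    that goes out and back along the same ray. *)
Lemma one_strand_null (e : sgraph V) (K : {set V}) v d :
  (forall k, e v k -> k \in K) -> v \notin K ->
  (exists2 H : V -> I * I -> C,
    (forall u, square (sval b u) (one_strand v d u) (base_strands u) (H u)) &
    forall w, {in v |: K &, forall i j, i != j -> H i w <> H j w}) ->
  isotopic b e (one_strand v d) base_strands.
Proof.
move=> eK vK [H sH aH].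
have sHk k : k \in K ->
    square (sval b k) (fun=> sval b k) (fun=> sval b k) (H k).
  move=> kK; have := sH k; rewrite /one_strand ifN//.
  by apply: contraNneq vK => <-.
have sHv := sH v; rewrite /one_strand eqxx in sHv.
(* the track of the strand k from the time of the homotopy back to time 0,
   where it rests at its base point *)
pose h (k : {k : V | k \in K}) (y : R * (I * I)) : C :=
  H (sval k) (clamp (val y.2.1 * (-1 * y.1 + 1)), y.2.2).
have ch k : continuous (h k).
  apply: track_continuous.
  - move=> y; apply: cvgM.
      apply: (@continuous_comp _ _ _ snd (fun w : I * I => val w.1)).
        exact: snd_continuous.
      exact: val_fst_continuous.
    by apply: (@affine_continuous R _ _ _ fst); exact: fst_continuous.
  - move=> y; apply: (@continuous_comp _ _ _ snd snd); exact: snd_continuous.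
  - by case: (sHk _ (svalP k)).
have h_neq u w i j : 0 <= u <= 1 -> i != j -> h i (u, w) <> h j (u, w).
  by move=> _ ij; apply: aH; rewrite ?finset.in_setU1 ?(svalP i) ?(svalP j) ?orbT.
have [phi [cphi inj at_ fix_ [M far]]] := transport square_compact ch h_neq.
have h1 k w : h k (1, w) = sval b (sval k).
  rewrite /h /= mulr1 addNr mulr0 -unitI_zeroE.
  by have [_ -> _ _ _] := sHk _ (svalP k).
have h0 k w : h k (0, w) = H (sval k) w.
  by rewrite /h /= mulr0 add0r mulr1 unitI_valK; case: w.
(* phi maps the complement of the strands of K to the fibre *)
have phi_avoid w z k : k \in K -> z <> H k w -> sval b k <> phi (w, z).
  move=> kK zH; have := at_ w (exist _ k kK); rewrite h1 h0 /= => <-.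
  by move/inj/esym.
have phi_id t z : t = zero \/ t = one -> phi ((one, t), z) = z.
  move=> tb; apply: fix_ => u k _; rewrite /h /=.
  by have [_ _ _ Hz Ho] := sHk _ (svalP k); case: tb => ->; rewrite ?Hz ?Ho.
have [p p1 ray] := escaping_ray v.
pose pi (r : R) : C := sval b v + r%:C%C * p.
have cpi : continuous pi.
  move=> r; apply: (@cvgD _ C); first exact: cst_continuous.
  by apply: (@cvgM R[i]); [exact: real_complex_continuous|exact: cst_continuous].
have pi0 : pi 0 = sval b v by rewrite /pi mul0r addr0.
pose r1 := `|M| + normc (sval b v).
have pi_far : M <= normc (pi r1).
  have r10 : 0 <= r1 by rewrite addr_ge0 ?normc_ge0.
  have r1p : r1 <= normc (r1%:C%C * p).
    by rewrite normcM normc_real ger0_norm// ler_peMr.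
  have := normc_triangle (pi r1) (- sval b v).
  rewrite normc_opp (_ : pi r1 - sval b v = r1%:C%C * p); last first.
    by rewrite addrC addKr.
  by have := ler_norm M; rewrite /r1 in r1p *; lra.
have pi_avoid r k : k \in K -> pi r <> sval b k.
  by move=> kK /esym; apply: ray; apply: contraNneq vK => <-.
pose eta t := phi ((one, t), sval b v).
have step1 : isotopic b e (one_strand v d) (one_strand v eta).
  apply: (one_strand_isotopic (D := fun w => phi (w, H v w))).
    have [cHv Hv0 Hv1 Hvz Hvo] := sHv; split.
    - move=> w; apply: (@continuous_comp _ _ _ (fun w => (w, H v w)) phi);
        last exact: cphi.
      by apply: pair_continuous; [move=> ?; exact: cvg_id|exact: cHv].
    - move=> t; rewrite Hv0; apply: fix_ => u k _.
      by rewrite /h /= val0 !mul0r.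
    - by move=> t; rewrite Hv1.
    - move=> s; rewrite Hvz; apply: fix_ => u k _; rewrite /h /=.
      by have [_ _ _ Hz _] := sHk _ (svalP k); rewrite !Hz.
    - move=> s; rewrite Hvo; apply: fix_ => u k _; rewrite /h /=.
      by have [_ _ _ _ Ho] := sHk _ (svalP k); rewrite !Ho.
  move=> w k /eK kK; apply: phi_avoid => //; apply: aH.
  - exact: finset.setU11.
  - by rewrite finset.in_setU1 kK orbT.
  - by apply: contraNneq vK => ->.
(* run out along the ray during the first third of the loop, at most up to s,
   and back during the last third; at s = 1, eta is run through in between *)
pose tent (s t : R) := Num.min s (Num.min (3 * t + 0) (-3 * t + 3)).
have tent_s0 s : 0 <= s -> tent s 0 = 0.
  by move=> s0; rewrite /tent [X in Num.min s X]min_l ?min_r; lra.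
have tent_s1 s : 0 <= s -> tent s 1 = 0.
  by move=> s0; rewrite /tent [X in Num.min s X]min_r ?min_r; lra.
have tent_0t t : 0 <= t <= 1 -> tent 0 t = 0.
  by move=> /andP[t0 t1]; rewrite /tent min_l// le_min; apply/andP; split; lra.
pose kappa (t : I) := pi (r1 * tent 1 (val t)).
have ctent (a c : I * I -> R) : continuous a -> continuous c ->
    continuous (fun w => pi (r1 * tent (a w) (c w))).
  move=> ca cc; apply: (continuous_comp_fun (g := pi)); last exact: cpi.
  have cm : continuous (fun w => tent (a w) (c w)).
    apply: (@min_fun_continuous _ _ _ a
      (fun w => Num.min (3 * c w + 0) (-3 * c w + 3))) => //.
    by apply: (@min_fun_continuous _ _ _ (fun w => 3 * c w + 0)
      (fun w => -3 * c w + 3)); exact: affine_continuous.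
  by move=> w; apply: cvgM; [exact: cvg_cst|exact: cm].
have val01 (t : I) : 0 <= val t <= 1 by rewrite unitI_ge0 unitI_le1.
have step2 : isotopic b e (one_strand v eta) (one_strand v kappa).
  pose D (w : I * I) := phi ((one,
    clamp (val w.2 + val w.1 * (2 * val w.2 + -1))),
    pi (r1 * tent (val w.1) (val w.2))).
  apply: (one_strand_isotopic (D := D)).
    split.
    - apply: (continuous_comp_fun (g := phi)); last exact: cphi.
      apply: pair_continuous; last first.
        apply: ctent; [exact: val_fst_continuous|exact: val_snd_continuous].
      apply: pair_continuous; first exact: cst_continuous.
      apply: (continuous_comp_fun (g := @clamp R)); last exact: clamp_continuous.
      move=> w; apply: (@cvgD R R^o); first exact: val_snd_continuous.
      apply: cvgM; first exact: val_fst_continuous.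
      by apply: (affine_continuous (u := fun w : I * I => val w.2));
        exact: val_snd_continuous.
    - move=> t; rewrite /D /= val0 mul0r addr0 unitI_valK tent_0t// mulr0.
      by rewrite pi0.
    - move=> t; rewrite /D /= val1 mul1r -/(kappa t).
      have [t3|t3] := leP (val t) 3^-1.
        by rewrite clamp_le0 -?unitI_zeroE; [apply: phi_id; left|lra].
      have [t3'|t3'] := leP (2 / 3) (val t).
        by rewrite clamp_ge1 -?unitI_oneE; [apply: phi_id; right|lra].
      apply: far; rewrite /kappa (_ : tent 1 _ = 1) ?mulr1//.
      by rewrite /tent min_l// le_min; apply/andP; split; lra.
    - move=> s; rewrite /D /= val0 tent_s0 ?unitI_ge0// !mulr0 pi0.
      apply: phi_id; left; rewrite clamp_le0//.
      by have := val01 s; lra.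
    - move=> s; rewrite /D /= val1 tent_s1 ?unitI_ge0// !mulr0 pi0.
      apply: phi_id; right; rewrite clamp_ge1//.
      by have := val01 s; lra.
  move=> w k /eK kK; apply: phi_avoid => //.
  by have [_ _ -> _ _] := sHk k kK; exact: pi_avoid.
have step3 : isotopic b e (one_strand v kappa) base_strands.
  have -> : base_strands = one_strand v (fun=> sval b v).
    by apply/funext => u; rewrite /one_strand; case: eqP => [->|].
  apply: (one_strand_isotopic
    (D := fun w => pi (r1 * tent (-1 * val w.1 + 1) (val w.2)))).
    split.
    - apply: ctent; last exact: val_snd_continuous.
      by apply: (affine_continuous (u := fun w : I * I => val w.1));
        exact: val_fst_continuous.
    - by move=> t /=; rewrite val0 mulr0 add0r.
    - by move=> t /=; rewrite val1 mulr1 addNr tent_0t// mulr0 pi0.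
    - move=> s /=; rewrite val0 tent_s0 ?mulr0 ?pi0//.
      by have := val01 s; lra.
    - move=> s /=; rewrite val1 tent_s1 ?mulr0 ?pi0//.
      by have := val01 s; lra.
  by move=> w k /eK kK; apply/nesym/pi_avoid.
exact: isotopic_trans step1 (isotopic_trans step2 step3).
Qed.

End Lifting.

(** * Simplicial vertices of chordal graphs *)

Section Dirac.
Variables (V : finType) (G : sgraph V) (Gc : chordal G).
Implicit Types (A B : {set V}) (p : seq V).

Definition simplicial A v : Prop :=
  {in A &, forall i j, G v i -> G v j -> i != j -> G i j}.

Lemma next_cat_cons (s1 s2 : seq V) u w a :
  uniq (a :: s1 ++ u :: w :: s2) -> next (a :: s1 ++ u :: w :: s2) u = w.
Proof.
move=> uc; rewrite next_nth inE mem_cat !inE eqxx !orbT.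
have au : (a == u) = false.
  by apply/negbTE; move: uc; rewrite cons_uniq mem_cat !inE !negb_or;
    case/andP => /and3P[].
have us1 : u \notin s1.
  by move: uc; rewrite cons_uniq cat_uniq /= negb_or; case/and4P => _ _ /andP[].
by rewrite /= au index_cat (negbTE us1) /= eqxx addn0 nth_cat ltnNge leqnSn /=
  subSnn.
Qed.

(** Closing a path from [x] to [y] through [B] by the vertex [a] gives a cycle of
    length at least 4.  None of its chords ends at [a] or joins [x] to [y], so a
    chord shortens the path; a shortest path thus has none. *)
Lemma no_detour B a x y p :
  G a x -> G a y -> ~~ G x y -> x != y -> a \notin B ->
  (forall z, z \in B -> ~~ G a z) ->
  path G x p -> last x p = y -> uniq (x :: p) ->
  all (fun z => (z \in B) || (z == y)) p -> False.
Proof.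
move=> Gax Gay Gxy xy aB GaB; have [n] := ubnP (size p).
elim: n p => // n IH p /ltnSE pn Gp lp up Bp.
have ax : a != x by apply/eqP => ax; move: Gax; rewrite ax adj_irr.
have ay : a != y by apply/eqP => ay; move: Gay; rewrite ay adj_irr.
have xB z : z \in p -> ~~ G a z || (z == y).
  by move=> /(allP Bp)/orP[/GaB ->//|->]; rewrite orbT.
have ap : a \notin p.
  by apply/negP => /(allP Bp); rewrite (negbTE aB) (negbTE ay).
pose c := a :: x :: p.
have uc : uniq c by rewrite /c cons_uniq inE negb_or ax ap up.
have p2 : (2 <= size p)%N.
  case: (p) lp Gp => [/= xy'|z [|//] /= ->]; first by rewrite xy' eqxx in xy.
  by rewrite (negbTE Gxy).
have cc : is_cycle G c.
  apply/and3P; split=> //; first by rewrite /= ltnW.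
  by rewrite /c /= rcons_path Gax Gp /= lp adj_sym.
have [|u [w /and4P[uc' wc' uw /forall_inP chord]]] := Gc cc; first by [].
have nexta : next c a = x by rewrite next_nth mem_head /= eqxx.
have nexty : next c y = a.
  rewrite next_nth -{1}lp inE mem_last orbT.
  have -> : index y c = size (x :: p).
    rewrite -[index y c]/((if a == y then 0 else (index y (x :: p)).+1)%N).
    by rewrite (negbTE ay) -lp index_last.
  by rewrite /c /= nth_default.
have na z : z \in c -> G a z -> (forall t, t \in c ->
    [set a; z]%SET != [set t; next c t]%SET) -> False.
  move=> zc Gaz nz; move: zc; rewrite !inE => /or3P[/eqP za|/eqP zx|zp].
  - by move: Gaz; rewrite za adj_irr.
  - by have := nz _ (mem_head _ _); rewrite nexta zx eqxx.
  - have := xB _ zp; rewrite Gaz /= => /eqP zy.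
    have yc : y \in c by rewrite -zy !inE zp !orbT.
    by have := nz _ yc; rewrite nexty zy finset.setUC eqxx.
have ua : u != a by apply/eqP => ua; apply: (na w) => //; rewrite -ua.
have wa : w != a.
  apply/eqP => wa; apply: (na u) => //; first by rewrite -wa adj_sym.
  by move=> t tc; rewrite finset.setUC -wa; exact: chord.
have uxp : u \in x :: p by move: uc'; rewrite inE (negbTE ua).
have wxp : w \in x :: p by move: wc'; rewrite inE (negbTE wa).
(* a chord of the path x :: p lets it be shortened *)
have short s1 m s2 u' w' : x :: p = s1 ++ u' :: m ++ w' :: s2 -> G u' w' ->
    (forall t, t \in c -> [set u'; w']%SET != [set t; next c t]%SET) -> False.
  move=> E Guw' nc; case: m E => [|z m] E.
    have u'c : u' \in c by rewrite /c E inE mem_cat mem_head !orbT.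
    have := nc _ u'c; rewrite /c E cat0s next_cat_cons ?eqxx//.
    by move: uc; rewrite /c E.
  have IHq q : subseq q p -> (size q < size p)%N -> path G x q ->
      last x q = y -> False.
    move=> qp sqp Gq lq; apply: (IH q) => //.
    - exact: leq_trans sqp pn.
    - by apply: subseq_uniq up; rewrite /= eqxx.
    - by apply/allP => t /(mem_subseq qp)/(allP Bp).
  have sm : subseq (w' :: s2) ((z :: m) ++ w' :: s2) := suffix_subseq _ _.
  case: s1 E => [[xu pE]|x' s1 [xx pE]].
    apply: (IHq (w' :: s2)); rewrite ?pE//.
    + by rewrite /= size_cat /= ltnS addnS ltnS leq_addl.
    + move: Gp; rewrite pE -cat_cons cat_path => /andP[_].
      by rewrite /= xu Guw' => /andP[_].
    + by rewrite -lp pE /= last_cat.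
  apply: (IHq (s1 ++ u' :: w' :: s2)); rewrite ?pE.
  + by rewrite cat_subseq //= eqxx.
  + by rewrite !size_cat /= ltn_add2l !ltnS size_cat /= addnS ltnS leq_addl.
  + move: Gp; rewrite pE !cat_path /= cat_path /= => /and4P[-> -> _].
    by rewrite Guw' => /and3P[_ _ ->].
  + by rewrite -lp pE !last_cat /= last_cat.
have [s1 [s2 E]] : exists s1 s2, x :: p = s1 ++ u :: s2.
  by case/splitPr: uxp => s1 s2; exists s1, s2.
have wu : w != u by apply/eqP => wu; move: uw; rewrite wu adj_irr.
move: wxp; rewrite E mem_cat inE (negbTE wu) /= => /orP[] /splitPr S.
  case: S E => s3 s4; rewrite -catA cat_cons => E; apply: (short _ _ _ _ _ E).
    by rewrite adj_sym.
  by move=> t tc; rewrite finset.setUC; exact: chord.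
by case: S E => s3 s4 E; exact: (short _ _ _ _ _ E).
Qed.

(** Let [B] be the component of [w] in [A] minus the closed neighbourhood of [a],
    and [S] the set of its neighbours in [A].  Then [S] lies in the
    neighbourhood of [a], so it is a clique by [no_detour].  A vertex of [B] that
    is simplicial in [B + S] is simplicial in [A], and it is found by induction,
    applied to [B + S] if some vertex of [S] is not joined to all of it, and to [B]
    otherwise. *)
Lemma simplicial_far A a w : a \in A -> w \in A -> w != a -> ~~ G a w ->
  exists v, [/\ v \in A, simplicial A v, v != a & ~~ G a v].
Proof.
have [n] := ubnP #|A|; elim: n A a w => // n IH A a w /ltnSE An aA wA wa Gaw.
pose U := [set z in A | (z != a) && ~~ G a z]%SET.
pose e := [rel z z' | [&& G z z', z \in U & z' \in U]].
have e_sym : connect_sym e.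
  apply: sym_connect_sym => z z' /=; rewrite adj_sym; congr andb.
  by rewrite andbC.
pose B := [set z | connect e w z]%SET.
have wU : w \in U by rewrite inE wA wa.
have BU z : z \in B -> z \in U.
  rewrite inE => /connectP[p]; elim/last_ind: p => [_ -> //|p t _].
  by rewrite rcons_path last_rcons => /andP[_ /and3P[_ _ +]] ->.
have BA z : z \in B -> [/\ z \in A, z != a & ~~ G a z].
  by move=> /BU; rewrite inE => /and3P.
pose S := [set s in A | (s \notin B) && [exists z in B, G s z]]%SET.
have Sa s : s \in S -> G a s.
  rewrite inE => /and3P[sA sB /exists_inP[z zB Gsz]].
  have [_ za Gaz] := BA z zB.
  apply: contraNT sB => Gas; rewrite inE.
  have wz : connect e w z by move: zB; rewrite inE.
  apply: (connect_trans wz); apply: connect1.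
  rewrite /= (adj_sym G z) Gsz BU//= inE sA Gas andbT /=.
  by apply/eqP => sa; move: Gsz; rewrite sa (negbTE Gaz).
have S_clique : {in S &, forall x y, x != y -> G x y}.
  move=> x y xS yS xy; apply/negPn/negP => Gxy.
  have := xS; rewrite inE => /and3P[xA xB /exists_inP[x' x'B Gxx']].
  have := yS; rewrite inE => /and3P[yA yB /exists_inP[y' y'B Gyy']].
  have : connect e x' y'.
    move: x'B y'B; rewrite !inE => wx' wy'.
    by apply: connect_trans wy'; rewrite e_sym.
  case/connectP => p ep y'E.
  have Gp : path G x (x' :: rcons p y).
    rewrite /= Gxx' rcons_path -y'E adj_sym Gyy' andbT.
    by apply: sub_path ep => ? ? /= /and3P[].
  have pB : all (fun z => (z \in B) || (z == y)) (x' :: rcons p y).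
    rewrite /= x'B /= all_rcons eqxx orbT /=; apply/allP => z zp.
    rewrite inE; apply/orP; left.
    move: x'B; rewrite inE => /connect_trans; apply.
    by apply: (path_connect ep); rewrite inE zp orbT.
  have lp : last x (x' :: rcons p y) = y by rewrite /= last_rcons.
  case/shortenP: Gp lp pB => q Gq uq sq lq pB.
  apply: (no_detour (Sa _ xS) (Sa _ yS) Gxy xy _ _ Gq lq uq).
  - by apply/negP => /BA[_]; rewrite eqxx.
  - by move=> z /BA[].
  - by apply/allP => z /sq/(allP pB).
pose D := (B :|: S)%SET.
have DA z : z \in D -> z \in A.
  by rewrite finset.in_setU => /orP[/BA[]//|]; rewrite inE => /andP[].
have ltD : (#|D| < #|A|)%N.
  apply: proper_card; apply/properP; split; first exact/fintype.subsetP.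
  exists a => //; rewrite finset.in_setU negb_or; apply/andP; split.
    by apply/negP => /BA[_]; rewrite eqxx.
  by apply/negP => /Sa; rewrite adj_irr.
have nbrs v z : v \in B -> z \in A -> G v z -> z \in D.
  move=> vB zA Gvz; rewrite finset.in_setU.
  have [//|zB/=] := boolP (z \in B); rewrite inE zA zB /=.
  by apply/exists_inP; exists v => //; rewrite adj_sym.
suff [v vB sv] : exists2 v, v \in B & simplicial D v.
  have [vA va Gav] := BA v vB; exists v; split=> // i j iA jA vi vj.
  by apply: sv => //; exact: nbrs vB _ _.
have Dn : (#|D| < n)%N := leq_trans ltD An.
have [/existsP[s /andP[sS /exists_inP[z zD /andP[zs Gsz]]]]|] :=
  boolP [exists s in S, [exists z in D, (z != s) && ~~ G s z]].
  have sD : s \in D by rewrite finset.in_setU sS orbT.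
  have [v [vD sv vs Gsv]] := IH D s z Dn sD zD zs Gsz; exists v => //.
  move: vD; rewrite finset.in_setU => /orP[//|vS].
  by rewrite (S_clique _ _ sS vS) ?(eq_sym s)// in Gsv.
rewrite negb_exists_in => /forall_inP Suniv.
have SD s z : s \in S -> z \in D -> s != z -> G s z.
  move=> sS zD sz; have := Suniv s sS; rewrite negb_exists_in.
  by move=> /forall_inP/(_ z zD); rewrite eq_sym sz /= negbK.
suff [v vB sv] : exists2 v, v \in B & simplicial B v.
  exists v => // i j iD jD vi vj ij.
  have := iD; rewrite finset.in_setU => /orP[iB|iS]; last exact: SD.
  have := jD; rewrite finset.in_setU => /orP[jB|jS]; first exact: sv.
  by rewrite adj_sym SD// eq_sym.
have wB : w \in B by rewrite inE connect0.
have [/exists_inP[c cB /exists_inP[z zB /andP[zc Gcz]]]|] :=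
  boolP [exists c in B, [exists z in B, (z != c) && ~~ G c z]].
  have Bn : (#|B| < n)%N.
    by apply: leq_ltn_trans Dn; apply/subset_leq_card/finset.subsetUl.
  by have [v [vB sv _ _]] := IH B c z Bn cB zB zc Gcz; exists v.
rewrite negb_exists_in => /forall_inP Buniv; exists w => // i j iB jB _ _ ij.
have := Buniv i iB; rewrite negb_exists_in => /forall_inP/(_ j jB).
by rewrite eq_sym ij /= negbK.
Qed.

Lemma exists_simplicial A a : a \in A -> exists2 v, v \in A & simplicial A v.
Proof.
move=> aA; have [/exists_inP[c cA /exists_inP[z zA /andP[zc Gcz]]]|] :=
  boolP [exists c in A, [exists z in A, (z != c) && ~~ G c z]].
  by have [v [vA sv _ _]] := simplicial_far cA zA zc Gcz; exists v.
rewrite negb_exists_in => /forall_inP Auniv; exists a => // i j iA jA _ _ ij.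
have := Auniv i iA; rewrite negb_exists_in => /forall_inP/(_ j jA).
by rewrite eq_sym ij /= negbK.
Qed.

End Dirac.

(** * Adding a simplicial vertex *)

Section Induced.
Variables (V : finType) (G : sgraph V) (A : {set V}).

Definition induced_adj : rel V := fun i j => [&& G i j, i \in A & j \in A].

Lemma induced_sym : symmetric induced_adj.
Proof. by move=> i j; rewrite /induced_adj adj_sym [(i \in A) && _]andbC. Qed.

Lemma induced_irr : irreflexive induced_adj.
Proof. by move=> i; rewrite /induced_adj adj_irr. Qed.

Definition induced : sgraph V := SGraph induced_sym induced_irr.

Lemma inducedE i j : induced i j = [&& G i j, i \in A & j \in A].
Proof. by []. Qed.

End Induced.

Notation clique := (induced (complete_graph _)).

Lemma cliqueE (V : finType) (S : {set V}) i j :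
  clique S i j = [&& i != j, i \in S & j \in S].
Proof. by []. Qed.

Section Induction.
Variables (R : realType) (V : finType) (G : sgraph V) (b : basepoint R V).
Local Notation C := (Cplx R).
Local Notation I := (unitI R).
Implicit Types (A K S T : {set V}) (f g : V -> I -> C).

Lemma clique_sub S T : T \subset S -> subrel (clique T) (clique S).
Proof.
by move=> /fintype.subsetP TS i j; rewrite !cliqueE => /and3P[-> /TS -> /TS ->].
Qed.

Lemma clique_sub_induced A S : simplex G S -> S \subset A ->
  subrel (clique S) (induced G A).
Proof.
move=> /forall_inP sS /fintype.subsetP SA i j; rewrite cliqueE inducedE.
move=> /and3P[ij iS jS]; rewrite !SA// !andbT.
by have /forall_inP/(_ _ jS)/implyP := sS _ iS; apply.
Qed.

(** Only the strands of [S] matter to the clique on [S]. *)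
Lemma isotopic_clique S f g : (forall i, arc (sval b i) (f i)) ->
  (forall i, arc (sval b i) (g i)) -> strand_loop b (clique S) f ->
  {in S, f =1 g} -> isotopic b (clique S) f g.
Proof.
move=> af ag lf fg; have [H sH aH] := isotopic_refl lf.
apply: (isotopic_local (A := S)) aH => //.
  by move=> i j; rewrite cliqueE => /and3P[_ ->].
by move=> i iS; rewrite -fg//; exact: sH.
Qed.

Lemma isotopic_induced0 (e : sgraph V) f g :
  (forall i, arc (sval b i) (f i)) -> (forall i, arc (sval b i) (g i)) ->
  isotopic b (induced e finset.set0) f g.
Proof.
move=> af ag.
apply: (isotopic_local (A := finset.set0) (H := fun i _ => sval b i)) => //.
- by move=> i j; rewrite inducedE finset.in_set0 andbF.
- by move=> i; rewrite finset.in_set0.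
- by move=> w i j; rewrite inducedE finset.in_set0 andbF.
Qed.

Lemma base_strands_loop (e : sgraph V) : strand_loop b e (base_strands b).
Proof.
split=> [i|t i j ij /(svalP b) ij']; first exact: arc_cst.
by rewrite ij' adj_irr in ij.
Qed.

Definition link A v : {set V} := [set k in A | G v k]%SET.

Section Simplicial.
Variables (A : {set V}) (v : V) (vA : v \in A) (sv : simplicial G A v).

Lemma link_notin : v \notin link A v.
Proof. by rewrite inE adj_irr andbF. Qed.

Lemma link_sub : link A v \subset A :\ v.
Proof.
apply/fintype.subsetP => k; rewrite !inE => /andP[-> vk]; rewrite andbT.
by apply: contraTneq vk => ->; rewrite adj_irr.
Qed.

Lemma star_simplex : simplex G (v |: link A v)%SET.
Proof.
apply/forall_inP => i; rewrite finset.in_setU1 => iS.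
apply/forall_inP => j; rewrite finset.in_setU1 => jS; apply/implyP => ij.
case/orP: iS ij => [/eqP ->|iK]; case/orP: jS => [/eqP ->|jK]; rewrite ?eqxx//.
- by move=> _; move: jK; rewrite inE => /andP[].
- by move=> _; move: iK; rewrite inE adj_sym => /andP[].
- by move: iK jK; rewrite !inE => /andP[? ?] /andP[? ?]; exact: sv.
Qed.

Lemma star_sub : (v |: link A v)%SET \subset A.
Proof.
by apply/fintype.subsetP => k; rewrite !inE => /orP[/eqP ->//|/andP[]].
Qed.

Lemma simplex_sub S T : T \subset S -> simplex G S -> simplex G T.
Proof.
move=> /fintype.subsetP TS /forall_inP sS; apply/forall_inP => i iT.
apply/forall_inP => j jT; have /forall_inP/(_ _ (TS _ jT)) := sS _ (TS _ iT).
exact.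
Qed.

Lemma simplex_star S : simplex G S -> S \subset A -> v \in S ->
  S \subset (v |: link A v)%SET.
Proof.
move=> /forall_inP/(_ v) sS /fintype.subsetP SA vS.
apply/fintype.subsetP => k kS; rewrite !inE SA//=.
have /forall_inP/(_ _ kS) := sS vS.
by rewrite eq_sym; case: eqP => //= _ /implyP ->.
Qed.

Lemma induced_at k j : induced G A k j -> k = v -> j \in link A v.
Proof. by rewrite inducedE => /and3P[+ _ jA] kv; rewrite kv inE jA. Qed.

End Simplicial.

(** The form in which lifted strands are inserted: the edges at [v] end in its
    link, and these are the ones that the lift avoids. *)
Lemma strands_with_lift A v (e : sgraph V) (F : V -> I * I -> C) Phi :
  (forall j, e v j -> j \in link A v) ->
  (forall w i j, i != v -> j != v -> e i j -> F i w <> F j w) ->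
  (forall w k, k \in link A v -> F k w <> Phi w) ->
  avoids e (fun u => if u == v then Phi else F u).
Proof.
move=> ev aF aPhi w i j; case: eqP => [->|/eqP iv]; case: eqP => [->|/eqP jv].
- by rewrite adj_irr.
- by move=> /ev jK; apply/nesym/aPhi.
- by rewrite adj_sym => /ev iK; exact: aPhi.
- exact: aF.
Qed.

Hypothesis Gc : chordal G.

(** Surjectivity.  The empty simplex is allowed among the [S]: it is the link of
    an isolated vertex. *)
Lemma glue_strands A (gamma : {set V} -> V -> I -> C) :
  (forall S, simplex G S -> S \subset A -> strand_loop b (clique S) (gamma S)) ->
  (forall S T, simplex G S -> S \subset A -> T \subset S ->
    isotopic b (clique T) (gamma S) (gamma T)) ->
  exists2 f, strand_loop b (induced G A) f &
    forall S, simplex G S -> S \subset A -> isotopic b (clique S) f (gamma S).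
Proof.
have [n] := ubnP #|A|; elim: n A => // n IH A /ltnSE An lg cg.
have [A0|[a aA]] := set_0Vmem A.
  exists (base_strands b); first exact: base_strands_loop.
  move=> S sS; rewrite A0 finset.subset0 => /eqP S0; subst S.
  apply: isotopic_induced0 => i.
    by case: (base_strands_loop (clique finset.set0)).
  by case: (lg finset.set0 sS (finset.sub0set _)).
have [v vA sv] := exists_simplicial Gc aA.
have A'n : (#|A :\ v| < n)%N.
  by rewrite (cardsD1 v) vA add1n in An.
have A'A : A :\ v \subset A := subD1set A v.
have [f lf fg] := IH _ A'n
  (fun S sS SA => lg S sS (fintype.subset_trans SA A'A))
  (fun S T sS SA => cg S T sS (fintype.subset_trans SA A'A)).
pose K := link A v; pose K' := (v |: K)%SET.
have sK' : simplex G K' := star_simplex sv.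
have K'A : K' \subset A := star_sub vA.
have KK' : K \subset K' := finset.subsetUr _ _.
have lK' := lg _ sK' K'A.
have [H sH aH] : isotopic b (clique K) (gamma K') f.
  apply: isotopic_trans (cg _ _ sK' K'A KK') _; apply: isotopic_sym.
  by apply: fg; [exact: simplex_sub KK' sK'|exact: link_sub].
have [g' [Phi [sPhi aPhi]]] : exists (g' : I -> C) Phi,
    square (sval b v) (gamma K' v) g' Phi /\
    forall w k, k \in K -> H k w <> Phi w.
  apply: lift_strand => [k _|w i j iK jK ij||t k kK].
  - exact: sH.
  - by apply: aH; rewrite cliqueE ij iK jK.
  - by case: lK' => ac _; exact: ac.
  - case: lK' => _; apply.
    rewrite cliqueE finset.setU11 finset.in_setU1 kK orbT !andbT.
    by apply: contraNneq (link_notin A v) => kv; rewrite -{1}kv.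
have af i : arc (sval b i) (f i) by case: lf.
pose f1 u := if u == v then g' else f u.
have af1 i : arc (sval b i) (f1 i).
  by rewrite /f1; case: eqP => [->|//]; exact: square_arcr sPhi.
have g1 : isotopic b (clique K') (gamma K') f1.
  apply: (isotopic_local (A := K')
    (H := fun u => if u == v then Phi else H u)) => //.
  - by move=> i j; rewrite cliqueE => /and3P[_ ->].
  - by case: lK'.
  - by move=> i _; rewrite /f1; case: eqP => [->|].
  - apply: (@strands_with_lift A) => //.
      move=> j; rewrite cliqueE => /and3P[vj _]; rewrite finset.in_setU1.
      by rewrite eq_sym (negbTE vj).
    move=> w i j iv jv; rewrite cliqueE !finset.in_setU1 (negbTE iv) (negbTE jv).
    by move=> ij; apply: aH; rewrite cliqueE.
exists f1.
  split=> // t i j ij; rewrite /f1.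
  have [_ avf] := lf; have [_ _ Phi1 _ _] := sPhi.
  case: eqP => [iv|/eqP iv]; case: eqP => [jv|/eqP jv].
  - by move: ij; rewrite iv jv adj_irr.
  - have jK := induced_at ij iv.
    by rewrite -Phi1; have [_ _ <- _ _] := sH j; apply/nesym/aPhi.
  - rewrite adj_sym in ij; have iK := induced_at ij jv.
    by rewrite -Phi1; have [_ _ <- _ _] := sH i; apply/aPhi.
  - apply: avf; move: ij; rewrite !inducedE !inE iv jv.
    by case/and3P => -> -> ->.
move=> S sS SA; have [vS|vS] := boolP (v \in S).
  have SK' := simplex_star sS SA vS.
  apply: isotopic_trans (cg _ _ sK' K'A SK').
  by apply: isotopic_sub (isotopic_sym g1); exact: clique_sub.
have SA' : S \subset A :\ v by rewrite subsetD1 SA.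
apply: isotopic_trans (fg _ sS SA'); apply: isotopic_sym.
apply: isotopic_clique => //; first exact: isotopic_loopl (fg _ sS SA').
by move=> i iS; rewrite /f1 ifN//; apply: contraNneq vS => <-.
Qed.

(** Triviality of the kernel. *)
Lemma null_strands A f : strand_loop b (induced G A) f ->
  (forall S, simplex G S -> S \subset A ->
    isotopic b (clique S) f (base_strands b)) ->
  isotopic b (induced G A) f (base_strands b).
Proof.
have [n] := ubnP #|A|; elim: n A f => // n IH A f /ltnSE An lf f0.
have [A0|[a aA]] := set_0Vmem A.
  rewrite A0; apply: isotopic_induced0 => i; first by case: lf.
  by case: (base_strands_loop (induced G A)).
have [v vA sv] := exists_simplicial Gc aA.
have A'n : (#|A :\ v| < n)%N.
  by rewrite (cardsD1 v) vA add1n in An.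
have A'A : A :\ v \subset A := subD1set A v.
have GA'A : subrel (induced G (A :\ v)) (induced G A).
  by move=> i j; rewrite !inducedE !inE => /and3P[-> /andP[_ ->] /andP[_ ->]].
pose K := link A v; pose K' := (v |: K)%SET.
have sK' : simplex G K' := star_simplex sv.
have K'A : K' \subset A := star_sub vA.
have KK' : K \subset K' := finset.subsetUr _ _.
have [H sH aH] : isotopic b (induced G (A :\ v)) f (base_strands b).
  apply: IH => //.
    by case: lf => af avf; split=> // t i j /GA'A; exact: avf.
  by move=> S sS SA; apply: f0 => //; exact: fintype.subset_trans SA A'A.
have [g' [Phi [sPhi aPhi]]] : exists (g' : I -> C) Phi,
    square (sval b v) (f v) g' Phi /\
    forall w k, k \in K -> H k w <> Phi w.
  apply: lift_strand => [k _|w i j iK jK ij||t k kK].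
  - exact: sH.
  - apply: aH; apply: (clique_sub_induced (simplex_sub KK' sK')).
      exact: link_sub.
    by rewrite cliqueE ij iK jK.
  - by case: lf.
  - case: lf => _; apply; rewrite inducedE adj_sym.
    by move: kK; rewrite inE => /andP[-> ->].
have f1 : isotopic b (induced G A) f (one_strand b v g').
  exists (fun u => if u == v then Phi else H u).
    by move=> u; rewrite /one_strand; case: eqP => [->|_] //; exact: sH.
  apply: (@strands_with_lift A) => //.
    by move=> j vj; exact: induced_at vj _.
  move=> w i j iv jv ij; apply: aH; move: ij; rewrite !inducedE !inE iv jv.
  by case/and3P => -> -> ->.
apply: (isotopic_trans f1).
apply: (@one_strand_null _ _ _ _ K) => [k vk||].
- exact: induced_at vk _.
- exact: link_notin.
have [H' sH' aH'] : isotopic b (clique K') (one_strand b v g') (base_strands b).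
  apply: isotopic_trans (f0 _ sK' K'A); apply: isotopic_sym.
  by apply: isotopic_sub f1; exact: clique_sub_induced.
by exists H' => // w i j iK jK ij; apply: aH'; rewrite cliqueE ij iK jK.
Qed.

End Induction.

(** * Passage to fundamental groups *)

Section Restriction.
Variables (R : realType) (V : finType) (b : basepoint R V).
Local Notation C := (Cplx R).
Local Notation I := (unitI R).
Local Notation vertices S := {v : V | v \in S}.

(** Braids on a simplex become families of strands on [V], the missing strands
    resting at the base point. *)
Definition pad (S : {set V}) (T : Type) (F : vertices S -> T -> C)
    (v : V) (t : T) : C :=
  if insub v is Some u then F u t else sval b v.

Lemma padE (S : {set V}) T (F : vertices S -> T -> C) u : pad F (val u) = F u.
Proof. by apply/funext => t; rewrite /pad valK. Qed.

Lemma pad_in (S : {set V}) T (F : vertices S -> T -> C) v (vS : v \in S) :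
  pad F v = F (exist _ v vS).
Proof. by rewrite -padE. Qed.

Lemma pad_out (S : {set V}) T (F : vertices S -> T -> C) v :
  v \notin S -> pad F v = fun=> sval b v.
Proof. by move=> vS; apply/funext => t; rewrite /pad insubN. Qed.

Lemma isotopic_pad (S : {set V}) (f g : vertices S -> I -> C) :
  isotopic (base_restrict b S) (complete_graph _) f g <->
  isotopic b (clique S) (pad f) (pad g).
Proof.
split=> [[H sH aH]|[H sH aH]].
  exists (pad H).
    move=> v; have [vS|vS] := boolP (v \in S); last first.
      by rewrite !pad_out//; split=> //; exact: cst_continuous.
    by rewrite !pad_in; exact: sH.
  move=> w i j; rewrite cliqueE => /and3P[ij iS jS]; rewrite !pad_in.
  by apply: aH; apply: contra ij => /eqP[->].
exists (fun u => H (val u)).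
  by move=> u; have := sH (val u); rewrite !padE.
move=> w i j ij; apply: aH; rewrite cliqueE (valP i) (valP j) !andbT.
by apply: contra ij => /eqP/val_inj ->.
Qed.

Lemma homotopic_pad (S : {set V}) (p q : loop R
    (base (complete_graph (vertices S)) (base_restrict b S))) :
  homotopic p q <-> isotopic b (clique S) (pad (strands p)) (pad (strands q)).
Proof. by rewrite homotopic_isotopic isotopic_pad. Qed.

Lemma pad_loop (S : {set V}) (p : loop R
    (base (complete_graph (vertices S)) (base_restrict b S))) :
  strand_loop b (clique S) (pad (strands p)).
Proof. exact/isotopic_loopl/homotopic_pad/homotopic_refl. Qed.

Variable G : sgraph V.

Lemma res_class (S : simplices G) (p : loop R (base G b)) u :
  res b S (loop_class p) = loop_class u <->
  isotopic b (clique (sval S)) (strands p) (pad (strands u)).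
Proof.
rewrite /res /= pi1_map_class loop_classP homotopic_pad.
set q := loop_map _ _ _.
have pq : isotopic b (clique (sval S)) (pad (strands q)) (strands p).
  apply: isotopic_clique.
  - by case: (pad_loop q).
  - by case: (strands_loop p).
  - exact: pad_loop.
  - by move=> v vS; rewrite (pad_in _ vS).
split=> [|pu]; last exact: isotopic_trans pq pu.
by move=> qu; apply: isotopic_trans qu; exact: isotopic_sym.
Qed.

Lemma rho_class (S T : {set V}) (TS : T \subset S) p q :
  rho b TS (loop_class p) = loop_class q ->
  isotopic b (clique T) (pad (strands p)) (pad (strands q)).
Proof.
rewrite /rho /= pi1_map_class loop_classP homotopic_pad => pq.
apply: isotopic_trans pq.
have TS' := fintype.subsetP TS.
apply: isotopic_clique.
- by case: (pad_loop p).
- move=> i; set r := loop_map _ _ _.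
  by case: (pad_loop r).
- apply: isotopic_loopl (isotopic_sub (clique_sub TS) _).
  exact/isotopic_refl/pad_loop.
- move=> v vT; rewrite (pad_in _ vT) (pad_in _ (TS' _ vT)).
  apply/funext => t; rewrite /strands loop_mapE.
  by apply: (congr1 (coord (loop_fun p t))); exact: val_inj.
Qed.

Lemma induced_setT i j : induced G finset.setT i j = G i j.
Proof. by rewrite inducedE !finset.in_setT !andbT. Qed.

Lemma strand_loop_setT f :
  strand_loop b G f <-> strand_loop b (induced G finset.setT) f.
Proof.
by split=> -[af avf]; split=> // t i j;
  [rewrite induced_setT|rewrite -induced_setT]; exact: avf.
Qed.

Lemma loop_class_eq1 (p : loop R (base G b)) : loop_class p = 1%g <->
  isotopic b (induced G finset.setT) (strands p) (base_strands b).
Proof.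
rewrite -loop_class1 loop_classP homotopic_isotopic.
by split; apply: isotopic_sub => i j; rewrite induced_setT.
Qed.

Definition restrict (g : Gamma G b) : lim_P b G :=
  @exist _ (@compatible (simplices G) (@simplex_le V G)
      (fun S => P b (val S)) (fun S T TS => rho b TS))
    (fun S => res b S g) (fun S T TS => res_compatible TS g).

Lemma restrict_morphism :
  (restrict 1 = 1)%g * {morph restrict : u v / (u * v)%g}.
Proof.
split=> [|u v]; apply: limit_eq => S.
  by apply: (mulgI (res b S 1%g)); rewrite -gmulfM !mulg1.
exact: gmulfM.
Qed.

HB.instance Definition _ := isUMagmaMorphism.Build (Gamma G b) (lim_P b G)
  restrict restrict_morphism.

Hypothesis Gc : chordal G.

Lemma restrict_ker (g : Gamma G b) : restrict g = 1%g -> g = 1%g.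
Proof.
have [p ->] := loop_class_surj g => gE; apply/loop_class_eq1.
apply: (null_strands Gc).
  by apply/strand_loop_setT; exact: strands_loop.
move=> S sS _; have [->|[v vS]] := set_0Vmem S.
  apply: isotopic_induced0; first by case: (strands_loop p).
  by case: (base_strands_loop b G).
have Sn0 : simplex G S && (S != finset.set0).
  by rewrite sS; apply/finset.set0Pn; exists v.
have : res b (exist _ S Sn0) (loop_class p) = 1%g.
  by have := congr1 (limit_proj (exist _ S Sn0)) gE.
rewrite -loop_class1 => /res_class /= pS; apply: (isotopic_trans pS).
apply: isotopic_clique.
- by case: (isotopic_loopr pS).
- by case: (base_strands_loop b G).
- exact: isotopic_loopr pS.
- by move=> u uS; rewrite (pad_in _ uS).
Qed.

Lemma restrict_inj : injective restrict.
Proof.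
move=> g h gh; apply: (mulIg h^-1%g); rewrite mulgV; apply: restrict_ker.
by rewrite !restrict_morphism gh -restrict_morphism mulgV restrict_morphism.
Qed.

Lemma restrict_surj (x : lim_P b G) : exists g, restrict g = x.
Proof.
(* the empty simplex has no entry in x, and only the trivial braid *)
pose gamma (S : {set V}) : V -> I -> C :=
  if (insub S : option (simplices G)) is Some S' then
    pad (strands (repr (limit_proj S' x))) else base_strands b.
have gammaE (S : simplices G) :
    gamma (sval S) = pad (strands (repr (limit_proj S x))).
  by rewrite /gamma (valK S).
have gamma0 : gamma finset.set0 = base_strands b.
  by rewrite /gamma insubN// eqxx andbF.
have simplexP S : simplex G S ->
    S = finset.set0 \/ exists S' : simplices G, S = sval S'.
  have [->|Sn0] := eqVneq S finset.set0; first by left.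
  move=> sS; right; have S' : simplex G S && (S != finset.set0) by rewrite sS.
  by exists (exist _ S S').
have gamma_loop S : simplex G S -> strand_loop b (clique S) (gamma S).
  case/simplexP => [->|[S' ->]].
    by rewrite gamma0; exact: base_strands_loop.
  by rewrite gammaE; exact: pad_loop.
have [S T sS _ TS|f lf fgamma] := glue_strands Gc (A := finset.setT)
    (fun S sS _ => gamma_loop S sS).
  have sT := simplex_sub TS sS.
  have [T0|[T' T'E]] := simplexP _ sT.
    rewrite T0; apply: isotopic_induced0; first by case: (gamma_loop _ sS).
    by rewrite -T0; case: (gamma_loop _ sT).
  have [S0|[S' S'E]] := simplexP _ sS.
    have T0 : T = finset.set0 by apply/eqP; rewrite -finset.subset0 -S0.
    rewrite S0 T0; apply: isotopic_induced0.
      by rewrite gamma0; case: (base_strands_loop b G).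
    by rewrite gamma0; case: (base_strands_loop b G).
  subst S T; rewrite !gammaE.
  apply: (@rho_class _ _ TS).
  by rewrite /loop_class !reprK; exact: (svalP x).
have [p pE] := strands_surj ((strand_loop_setT f).2 lf).
exists (loop_class p); apply: limit_eq => S.
have -> : limit_proj S x = loop_class (repr (limit_proj S x)).
  by rewrite /loop_class reprK.
apply/res_class; rewrite pE -gammaE; apply: fgamma; last exact: finset.subsetT.
by have /andP[] := svalP S.
Qed.

End Restriction.

Theorem theorem1 (R : realType) (V : finType) (G : sgraph V)
    (b : basepoint R V) :
  chordal G ->
  exists f : {multiplicative Gamma G b -> lim_P b G},
    bijective f /\
    forall (gamma : Gamma G b) (S : simplices G),
      limit_proj S (f gamma) = res b S gamma.
Proof.
move=> Gc; exists (restrict (b := b) (G := G)); split=> //.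
have [g gK] := choice (restrict_surj (b := b) Gc).
by exists g => // x; apply: (restrict_inj Gc); rewrite gK.
Qed.
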